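(* Let $1<\bar p<\infty$, where $\bar p=(p_1,p_2)$ and the inequalities are meant coordinatewise, let $\bar\sigma=\frac12-\frac1{\bar p}$, i.e. $\bar\sigma=(\sigma_1,\sigma_2)$ with $\sigma_i=\frac12-\frac1{p_i}$, and let $f(x_1,x_2)\in L_1[0,1]^2$ be a function that is monotonically non-increasing in each variable. Then, for $f\in L_{\bar p}[0,1]^2$ it is necessary and sufficient that the sequence of its Fourier-Haar coefficients $a=\{a_{k_1k_2}^{j_1j_2}:k_i\in\mathbb Z_+,\ 1\le j_i\le 2^{k_i},\ i=1,2\}$ belong to the space $l_{\bar p}^{\bar\sigma}(l_\infty)$, and the relation $$\|f\|_{L_{\bar p}[0,1]^2}\asymp\|a\|_{l_{\bar p}^{\bar\sigma}(l_\infty)}$$ holds.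
   Context: The relation $A\asymp B$ means $c_1B\le A\le c_2B$ with constants $c_1,c_2>0$ not depending on $f$. Mixed-metric Lebesgue space. $L_{\bar p}[0,1]^2$ is the set of functions $f$ measurable on $[0,1]^2$ for which $$\|f\|_{L_{\bar p}[0,1]^2}=\left(\int_0^1\left(\int_0^1|f(x_1,x_2)|^{p_1}dx_1\right)^{p_2/p_1}dx_2\right)^{1/p_2}$$ is finite. Monotonicity. The function $f(x_1,x_2)$ is called monotonically non-increasing in each variable if $f(x_1,x_2)\le f(y_1,y_2)$ whenever $0\le y_1\le x_1$ and $0\le y_2\le x_2$. Haar system. The Haar system on $[0,1]$ is $\{\chi_n\}_{n=1}^\infty$, where $\chi_1\equiv1$ and, for $n=2^k+j$ with $k=0,1,\dots$ and $j=1,\dots,2^k$, $$\chi_n(x)=\chi_k^j(x)=\begin{cases}2^{k/2}, & \frac{2j-2}{2^{k+1}}<x<\frac{2j-1}{2^{k+1}},\\ -2^{k/2}, & \frac{2j-1}{2^{k+1}}<x<\frac{2j}{2^{k+1}},\\ 0, & x\notin\left(\frac{j-1}{2^k},\frac{j}{2^k}\right).\end{cases}$$ Fourier-Haar coefficients. For $f\in L_1[0,1]^2$ the Fourier-Haar series is $$f(x_1,x_2)\sim\sum_{k_1=0}^\infty\sum_{k_2=0}^\infty\sum_{j_1=1}^{2^{k_1}}\sum_{j_2=1}^{2^{k_2}}a_{k_1k_2}^{j_1j_2}\chi_{k_1}^{j_1}(x_1)\chi_{k_2}^{j_2}(x_2),$$ with coefficients, for $k_i\in\mathbb Z_+=\{0,1,2,\dots\}$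 and $1\le j_i\le2^{k_i}$, $$a_{k_1k_2}^{j_1j_2}=\int_0^1\int_0^1 f(x_1,x_2)\chi_{k_1}^{j_1}(x_1)\chi_{k_2}^{j_2}(x_2)\,dx_1dx_2.$$ Sequence space. $l_{\bar p}^{\bar\sigma}(l_\infty)$ is the set of all sequences $a=\{a_{k_1k_2}^{j_1j_2}:k_i\in\mathbb Z_+,\ 1\le j_i\le2^{k_i},\ i=1,2\}$ for which $$\|a\|_{l_{\bar p}^{\bar\sigma}(l_\infty)}=\left(\sum_{k_2=0}^\infty\left(\sum_{k_1=0}^\infty\left(2^{\sigma_1k_1+\sigma_2k_2}\sup_{1\le j_i\le2^{k_i},\ i=1,2}|a_{k_1k_2}^{j_1j_2}|\right)^{p_1}\right)^{p_2/p_1}\right)^{1/p_2}$$ is finite.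
   Formalization: The coefficients against products containing χ_1 = 1 are included, in the level-0 blocks; without them f ≡ 1 has a = 0 but norm 1. Functions may take infinite values, and measurable means Borel measurable (the Lebesgue case follows by a change on a null set). *)

(* Defs.v *)
(* Library: MathComp-Analysis; the reals are an arbitrary [R : realType]. *)
From HB Require Import structures.
From mathcomp Require Import all_boot all_order all_algebra.
From mathcomp Require Import all_classical all_reals all_analysis.
From mathcomp Require Import measurable_realfun.

Set Implicit Arguments.
Unset Strict Implicit.
Unset Printing Implicit Defensive.

Import Order.TTheory GRing.Theory Num.Theory.
Import numFieldNormedType.Exports.

Local Open Scope classical_set_scope.
Local Open Scope ring_scope.

Definition unit_square (R : realType) : set (R * R) := `[0, 1] `*` `[0, 1].

(* The usual order on [\bar R] is used: [f] may take the values +oo and -oo, so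
   that unbounded functions such as x1^(-a) x2^(-b), which are infinite on the
   axes, are monotone on the closed square. For real-valued [f], monotonicity
   on the closed square would force boundedness. *)
Definition nonincreasing_each (R : realType) (f : R * R -> \bar R) : Prop :=
  forall x1 x2 y1 y2 : R,
    0 <= y1 -> y1 <= x1 -> x1 <= 1 ->
    0 <= y2 -> y2 <= x2 -> x2 <= 1 ->
    (f (x1, x2) <= f (y1, y2))%E.

Definition in_L1 (R : realType) (f : R * R -> \bar R) : Prop :=
  ((@lebesgue_measure R) \x (@lebesgue_measure R))%E.-integrable
    (@unit_square R) f.

Definition mixed_norm (R : realType) (p1 p2 : R) (f : R * R -> \bar R) :
    \bar R :=
  ((\int[@lebesgue_measure R]_(x2 in `[0%R, 1%R])
     ((\int[@lebesgue_measure R]_(x1 in `[0%R, 1%R])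
        (`|f (x1, x2)| `^ p1)) `^ (p2 / p1)%R)) `^ (p2^-1)%R)%E.

Definition in_mixed_L (R : realType) (p1 p2 : R) (f : R * R -> \bar R) : Prop :=
  measurable_fun (@unit_square R) f /\ (mixed_norm p1 p2 f < +oo)%E.

(* Indices (k, j) of the n-th Haar function, n = 2^k + j >= 1: k is arbitrary
   and 1 <= j <= 2^k, together with (k, j) = (0, 0) for n = 1, i.e. for the
   constant function chi_1 = 1. The coefficients against
   products containing chi_1 must be kept: a function of x1 alone has no other
   nonzero coefficients. *)
Definition haar_index (k j : nat) : bool :=
  (((k == 0) || (0 < j)) && (j <= 2 ^ k))%N.

(* The value at the midpoint of the dyadic interval is irrelevant; it is 0. *)
Definition haar (R : realType) (k j : nat) (x : R) : R :=
  if (k == 0%N) && (j == 0%N) then 1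
  else if (2 * j%:R - 2) / 2 ^+ k.+1 < x < (2 * j%:R - 1) / 2 ^+ k.+1
  then 2 `^ (k%:R / 2)
  else if (2 * j%:R - 1) / 2 ^+ k.+1 < x < 2 * j%:R / 2 ^+ k.+1
  then - 2 `^ (k%:R / 2)
  else 0.

(* [fine] loses nothing: the integral is finite for [f] in L_1. *)
Definition haar_coef (R : realType) (f : R * R -> \bar R)
    (k1 k2 j1 j2 : nat) : R :=
  fine (\int[(@lebesgue_measure R) \x (@lebesgue_measure R)]_(x in
          @unit_square R) (f x * (haar k1 j1 x.1 * haar k2 j2 x.2)%:E))%E.

Definition block_sup (R : realType) (a : nat -> nat -> nat -> nat -> R)
    (k1 k2 : nat) : \bar R :=
  ereal_sup [set `|a k1 k2 j.1 j.2|%:E |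
             j in [set j : nat * nat | haar_index k1 j.1 /\ haar_index k2 j.2]].

Definition seq_norm (R : realType) (p1 p2 s1 s2 : R)
    (a : nat -> nat -> nat -> nat -> R) : \bar R :=
  ((\sum_(0 <= k2 <oo)
     ((\sum_(0 <= k1 <oo)
        (((2 `^ (s1 * k1%:R + s2 * k2%:R))%R%:E * block_sup a k1 k2) `^ p1))
      `^ (p2 / p1)%R)) `^ (p2^-1)%R)%E.

Definition in_seq_space (R : realType) (p1 p2 s1 s2 : R)
    (a : nat -> nat -> nat -> nat -> R) : Prop :=
  (seq_norm p1 p2 s1 s2 a < +oo)%E.

(* Main.v *)
(* Near its corner (0, 0) the positive part of f is controlled by its values at
   the points (2^-n1, 2^-n2), and near (1, 1) the negative part of f by its
   values at (1 - 2^-n1, 1 - 2^-n2). By monotonicity the mixed norm of f is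
   comparable to the mixed l_p norm of these two arrays b, weighted by
   2^(-n1/p1) 2^(-n2/p2).
   A Haar coefficient of level (k1, k2) is at most 2^(k1/2) 2^(k2/2) times the
   integral of |f| over a dyadic rectangle; splitting the latter into pieces of
   geometrically decreasing sizes bounds this integral by the sum of
   2^-n1 2^-n2 b(n1 + 1, n2 + 1) over n1 >= k1 and n2 >= k2.
   Conversely b(n1, n2) is at most the absolute value of the mean of f over the
   corner rectangle with sides 2^-n1 and 2^-n2 (when b(n1, n2) is nonzero, f has
   constant sign there), and the indicator functions of the corner rectangles
   telescope into products of Haar functions adjacent to the corner, of levels
   below (n1, n2).
   Both directions then follow from a discrete Hardy inequality: a geometrically
   weighted sum of shifts of an array is bounded in mixed l_p. *)
Require Import Defs.
From HB Require Import structures.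
From mathcomp Require Import all_boot all_order all_algebra.
From mathcomp Require Import all_classical all_reals all_analysis.
From mathcomp Require Import measurable_realfun.
From mathcomp Require Import ring lra.

Set Implicit Arguments.
Unset Strict Implicit.
Unset Printing Implicit Defensive.

Import Order.TTheory GRing.Theory Num.Theory.
Import numFieldNormedType.Exports.

Local Open Scope classical_set_scope.
Local Open Scope ring_scope.

(** * Series of nonnegative extended reals *)

Section series.
Context {R : realType}.
Implicit Types (p q r s : R) (x y : \bar R) (u v : nat -> \bar R).
Local Open Scope ereal_scope.

Lemma le_poweR x y r : (0 <= r)%R -> 0 <= x -> x <= y -> x `^ r <= y `^ r.
Proof.
move=> r0 x0 xy; apply: gt0_ler_poweR => //; rewrite in_itv/= leey andbT//.
exact: le_trans xy.
Qed.

Lemma poweRK x r : (0 < r)%R -> 0 <= x -> (x `^ r) `^ r^-1 = x.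
Proof. by move=> r0 x0; rewrite -poweRrM divff ?gt_eqF// poweRe1. Qed.

Lemma poweRVK x r : (0 < r)%R -> 0 <= x -> (x `^ r^-1) `^ r = x.
Proof. by move=> r0 x0; rewrite -poweRrM mulVf ?gt_eqF// poweRe1. Qed.

Lemma poweRMl (a : R) x r : (0 <= a)%R -> 0 <= x ->
  (a%:E * x) `^ r = (a `^ r)%:E * x `^ r.
Proof. by move=> a0 x0; rewrite poweRM. Qed.

(** Bound the sum by twice the larger term. This treats exponents below and above 1 alike, which
    matters because the outer exponent [p2 / p1] may be either. *)
Lemma poweRD_le x y r : (0 < r)%R -> 0 <= x -> 0 <= y ->
  (x + y) `^ r <= (2 `^ r)%:E * (x `^ r + y `^ r).
Proof.
move=> r0; wlog xy : x y / x <= y => [hw x0 y0|x0 y0].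
  have [|/ltW] := leP x y => xy; first exact: hw.
  by rewrite addeC [X in _ <= _ * X]addeC; exact: hw.
apply: (@le_trans _ _ ((2%:E * y) `^ r)).
  apply: le_poweR => //; [exact: ltW|exact: adde_ge0|].
  by rewrite mule_natl mule2n leeD2r.
by rewrite poweRMl// lee_wpmul2l// ?leeDr ?lee_fin ?powR_ge0 ?poweR_ge0.
Qed.

Lemma eseries_ge0 u : (forall k, 0 <= u k) -> 0 <= \sum_(0 <= k <oo) u k.
Proof. by move=> u0; exact: nneseries_ge0. Qed.

Lemma le_eseries u v : (forall k, 0 <= u k) -> (forall k, u k <= v k) ->
  \sum_(0 <= k <oo) u k <= \sum_(0 <= k <oo) v k.
Proof. by move=> u0 uv; exact: lee_nneseries. Qed.

Lemma nneseries_ge_term u m : (forall k, 0 <= u k) ->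
  u m <= \sum_(0 <= k <oo) u k.
Proof.
move=> u0; rewrite (@nneseriesD1 _ u m)// leeDl//.
exact: nneseries_ge0.
Qed.

(** The factor [x] may be [+oo]: then either some [f k] is positive and both sides are infinite, or
    all of them vanish and both sides are 0. *)
Lemma nneseriesZr (f : nat -> R) x : (forall k, (0 <= f k)%R) -> 0 <= x ->
  \sum_(0 <= k <oo) ((f k)%:E * x) = (\sum_(0 <= k <oo) (f k)%:E) * x.
Proof.
move=> f0; case: x => [x x0| _|//].
  under eq_eseriesr do rewrite muleC.
  by rewrite nneseriesZl ?(muleC x%:E)// => i _; rewrite lee_fin.
have [[k fk]|f00] := pselect (exists k, f k <> 0%R).
  have fk0 : (0 < f k)%R by rewrite lt_neqAle f0 eq_sym; move/eqP: fk => ->.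
  rewrite gt0_muley; last first.
    apply: (@lt_le_trans _ _ (f k)%:E); first by rewrite lte_fin.
    by apply: (nneseries_ge_term (u := EFin \o f)) => i /=; rewrite lee_fin.
  apply: (nneseries_pinfty (k := k)) => //.
    by move=> n _; rewrite mule_ge0// lee_fin.
  by rewrite gt0_muley// lte_fin.
have {}f00 k : f k = 0%R.
  by apply: contrapT => fk; apply: f00; exists k.
by rewrite !eseries0 ?mul0e// => i _ _; rewrite f00 ?mul0e.
Qed.

Lemma nneseries_geometric r : (0 <= r < 1)%R ->
  \sum_(0 <= k <oo) (r ^+ k)%:E = ((1 - r)^-1)%:E.
Proof.
move=> /andP[r0 r1]; apply/cvg_lim => //.
under eq_fun do rewrite sumEFin.
apply: cvg_EFin; first exact: nearW.
have := @cvg_geometric_series _ 1%R r.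
rewrite ger0_norm// => /(_ r1).
rewrite mul1r; apply: cvg_trans; apply: near_eq_cvg; apply: nearW => n /=.
by rewrite /series/=; apply: eq_bigr => i _; rewrite /geometric/= mul1r.
Qed.

Lemma nneseries_addn_le u m : (forall k, 0 <= u k) ->
  \sum_(0 <= k <oo) u (k + m)%N <= \sum_(0 <= k <oo) u k.
Proof.
move=> u0; rewrite nneseries_addn// [leRHS](@nneseries_split _ _ _ m)//.
by rewrite add0n leeDr// sume_ge0.
Qed.

Lemma nneseries_subn u m : (forall k, 0 <= u k) ->
  \sum_(0 <= k <oo) (if (m <= k)%N then u (k - m)%N else 0) =
  \sum_(0 <= k <oo) u k.
Proof.
move=> u0; rewrite (@nneseries_split _ _ _ m); last by move=> k _; case: ifP.
rewrite big_nat big1 ?add0e; last by move=> i /andP[_]; rewrite ltnNge => /negbTE ->.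
rewrite add0n -nneseries_addn; last by move=> i; case: ifP.
by apply: eq_eseriesr => i _; rewrite leq_addl addnK.
Qed.

Lemma nneseries_finite u m : (forall k, (m <= k)%N -> u k = 0) ->
  \sum_(0 <= k <oo) u k = \sum_(k < m) u k.
Proof.
move=> u0; apply: lim_near_cst => //; exists m => // n /= mn.
rewrite (big_cat_nat (n:=m))//= big_mkord -[RHS]adde0; congr (_ + _).
rewrite big_nat big1//.
by move=> i /andP[mi _]; exact: u0.
Qed.

(* Writing [r = s * s], the sum is at most [sup_m s^m u_m] times a convergent
   geometric series, and the [q]-th power of the supremum is at most the sum of
   the [q]-th powers; this treats [q <= 1] and [q >= 1] alike. *)
Lemma poweR_geometric_sum q r : (0 < q)%R -> (0 < r < 1)%R ->
  exists C rho : R, [/\ (0 < C)%R, (0 < rho < 1)%R &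
    forall u, (forall m, 0 <= u m) ->
      (\sum_(0 <= m <oo) ((r ^+ m)%:E * u m)) `^ q <=
      C%:E * \sum_(0 <= m <oo) ((rho ^+ m)%:E * u m `^ q)].
Proof.
move=> q0 /andP[r0 r1]; set s := Num.sqrt r.
have s0 : (0 < s)%R by rewrite sqrtr_gt0.
have s1 : (s < 1)%R by rewrite -sqrtr1 ltr_sqrt.
have ss : (s * s = r)%R by rewrite -expr2 sqr_sqrtr ?ltW.
have s1' : (0 < (1 - s)^-1)%R by rewrite invr_gt0 subr_gt0.
exists ((1 - s)^-1 `^ q)%R, (s `^ q)%R; split.
- exact: powR_gt0.
- rewrite powR_gt0//=; have := @gt0_ltr_powR _ q q0 s 1%R.
  by rewrite powR1 !nnegrE; apply => //; exact: ltW.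
move=> u u0.
set T := (X in _ <= _ * X).
have T0 : 0 <= T.
  by apply: eseries_ge0 => n; rewrite mule_ge0 ?lee_fin ?exprn_ge0 ?powR_ge0 ?poweR_ge0.
have sT m : (s ^+ m)%:E * u m <= T `^ q^-1.
  rewrite -[leLHS](@poweRK _ q)//; last first.
    by rewrite mule_ge0// lee_fin exprn_ge0// ltW.
  apply: le_poweR; [by rewrite invr_ge0 ltW|exact: poweR_ge0|].
  rewrite poweRMl//; last by rewrite exprn_ge0// ltW.
  rewrite -powR_mulrn ?(ltW s0)// powRAC powR_mulrn ?powR_ge0//.
  apply: (nneseries_ge_term (u := fun m => ((s `^ q) ^+ m)%:E * u m `^ q)).
  by move=> k; rewrite mule_ge0 ?lee_fin ?exprn_ge0 ?powR_ge0 ?poweR_ge0.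
apply: (@le_trans _ _ (((1 - s)^-1%:E * T `^ q^-1) `^ q)); last first.
  by rewrite poweRMl ?poweR_ge0 ?(ltW s1')// poweRVK.
apply: le_poweR; first exact: ltW.
  by apply: eseries_ge0 => m; rewrite mule_ge0// lee_fin exprn_ge0// ltW.
rewrite -nneseries_geometric ?s1 ?(ltW s0)// -nneseriesZr ?poweR_ge0//; last first.
  by move=> k; rewrite exprn_ge0// ltW.
apply: le_eseries => m.
  by rewrite mule_ge0// lee_fin exprn_ge0// ltW.
rewrite -ss exprMn EFinM -muleA lee_wpmul2l//.
by rewrite lee_fin exprn_ge0// ltW.
Qed.

(** Apply [poweR_geometric_sum] for each [k] and interchange the two nonnegative series. *)
Lemma hardy_geometric q r : (0 < q)%R -> (0 < r < 1)%R ->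
  exists C rho : R, [/\ (0 < C)%R, (0 < rho < 1)%R &
    forall X : nat -> nat -> \bar R, (forall m k, 0 <= X m k) ->
      \sum_(0 <= k <oo) (\sum_(0 <= m <oo) ((r ^+ m)%:E * X m k)) `^ q <=
      C%:E * \sum_(0 <= m <oo)
        ((rho ^+ m)%:E * \sum_(0 <= k <oo) (X m k) `^ q)].
Proof.
move=> q0 r01; have [C [rho [C0 rho01 W]]] := poweR_geometric_sum q0 r01.
have rho0 m : (0 <= rho ^+ m)%R by case/andP: rho01 => ? _; rewrite exprn_ge0// ltW.
have ge0 X m k : 0 <= (rho ^+ m)%:E * (X m k : \bar R) `^ q.
  by rewrite mule_ge0 ?lee_fin ?poweR_ge0.
exists C, rho; split => // X X0.
apply: (@le_trans _ _ (\sum_(0 <= k <oo) (C%:E *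
    \sum_(0 <= m <oo) ((rho ^+ m)%:E * X m k `^ q)))).
  apply: le_eseries => k; first exact: poweR_ge0.
  by apply: W => m.
rewrite nneseriesZl; last by move=> k _; apply: eseries_ge0 => m; exact: ge0.
apply: lee_wpmul2l; first by rewrite lee_fin ltW.
rewrite nneseries_interchange; last by move=> k m; exact: ge0.
rewrite le_eqVlt; apply/orP; left; apply/eqP; apply: eq_eseriesr => m _.
by rewrite nneseriesZl// => k _; exact: poweR_ge0.
Qed.

(** Three uses of [hardy_geometric]: with exponent [p] for the sum over [m2] and then for the sum
    over [m1], and with exponent [q] for the series over [m2] that the first use leaves behind. As
    [Y] does not depend on [m1] and [Z] depends on no index, the remaining geometric series sum to
    constants. *)
Lemma hardy_geometric_mixed p q r1 r2 : (0 < p)%R -> (0 < q)%R ->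
  (0 < r1 < 1)%R -> (0 < r2 < 1)%R ->
  exists C : R, (0 < C)%R /\
    forall (X : nat -> nat -> nat -> nat -> \bar R) (Y : nat -> nat -> \bar R) Z,
      (forall m1 m2 k1 k2, 0 <= X m1 m2 k1 k2) -> (forall m k, 0 <= Y m k) ->
      0 <= Z ->
      (forall m1 m2 k2, \sum_(0 <= k1 <oo) (X m1 m2 k1 k2) `^ p <= Y m2 k2) ->
      (forall m2, \sum_(0 <= k2 <oo) (Y m2 k2) `^ q <= Z) ->
      \sum_(0 <= k2 <oo) (\sum_(0 <= k1 <oo)
        (\sum_(0 <= m2 <oo) ((r2 ^+ m2)%:E *
          \sum_(0 <= m1 <oo) ((r1 ^+ m1)%:E * X m1 m2 k1 k2))) `^ p) `^ q <=
      C%:E * Z.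
Proof.
move=> p0 q0 r101 r201.
have [C1 [s1 [C10 s101 H1]]] := hardy_geometric p0 r101.
have [C2 [s2 [C20 s201 H2]]] := hardy_geometric p0 r201.
have [C3 [s3 [C30 s301 H3]]] := hardy_geometric q0 s201.
have geo (s : R) : (0 < s < 1)%R ->
    (0 < (1 - s)^-1)%R /\ (forall m, (0 <= s ^+ m)%R) /\
    forall x, 0 <= x -> \sum_(0 <= m <oo) ((s ^+ m)%:E * x) = (1 - s)^-1%:E * x.
  move=> /andP[s0 s1']; split; first by rewrite invr_gt0 subr_gt0.
  split=> [m|x x0]; first by rewrite exprn_ge0// ltW.
  rewrite nneseriesZr//; last by move=> k; rewrite exprn_ge0// ltW.
  by rewrite nneseries_geometric// s1' ltW.
have [G1 [s1m G1E]] := geo _ s101; have [G3 [s3m G3E]] := geo _ s301.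
have [_ [s2m _]] := geo _ s201; have [_ [r1m _]] := geo _ r101.
set C := (C2 * (C1 * (1 - s1)^-1))%R.
have C0 : (0 < C)%R by rewrite !mulr_gt0.
exists (C `^ q * (C3 * (1 - s3)^-1))%R; split.
  by rewrite !mulr_gt0 ?powR_gt0.
move=> X Y Z X0 Y0 Z0 XY YZ.
have inner k2 : \sum_(0 <= k1 <oo)
      (\sum_(0 <= m2 <oo) ((r2 ^+ m2)%:E *
        \sum_(0 <= m1 <oo) ((r1 ^+ m1)%:E * X m1 m2 k1 k2))) `^ p
    <= C%:E * \sum_(0 <= m2 <oo) ((s2 ^+ m2)%:E * Y m2 k2).
  apply: le_trans.
    apply: H2 => m2 k1; apply: eseries_ge0 => m1.
    by rewrite mule_ge0 ?lee_fin.
  rewrite /C EFinM -muleA lee_wpmul2l// ?lee_fin ?(ltW C20)//.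
  rewrite -nneseriesZl; last by move=> i _; rewrite mule_ge0 ?lee_fin.
  apply: le_eseries => m2.
    by rewrite mule_ge0 ?lee_fin ?eseries_ge0// => *; exact: poweR_ge0.
  rewrite [leRHS]muleCA lee_wpmul2l ?lee_fin//.
  apply: le_trans; first by apply: H1.
  rewrite EFinM -muleA lee_wpmul2l// ?lee_fin ?(ltW C10)// -G1E//.
  apply: le_eseries => m1.
    by rewrite mule_ge0 ?lee_fin ?eseries_ge0// => *; exact: poweR_ge0.
  by rewrite lee_wpmul2l ?lee_fin.
have sY k2 : 0 <= \sum_(0 <= m2 <oo) ((s2 ^+ m2)%:E * Y m2 k2).
  by apply: eseries_ge0 => m; rewrite mule_ge0 ?lee_fin.
apply: (@le_trans _ _ (\sum_(0 <= k2 <oo) ((C `^ q)%:E *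
    (\sum_(0 <= m2 <oo) ((s2 ^+ m2)%:E * Y m2 k2)) `^ q))).
  apply: le_eseries => k2; first exact: poweR_ge0.
  rewrite -poweRMl ?(ltW C0)//; apply: le_poweR (inner k2); first exact: ltW.
  by apply: eseries_ge0 => *; exact: poweR_ge0.
rewrite nneseriesZl; last by move=> k _; exact: poweR_ge0.
rewrite EFinM -muleA lee_wpmul2l ?lee_fin ?powR_ge0//.
apply: le_trans; first exact: H3.
rewrite EFinM -muleA lee_wpmul2l ?lee_fin ?(ltW C30)// -G3E//.
apply: le_eseries => m.
  by rewrite mule_ge0 ?lee_fin ?eseries_ge0// => *; exact: poweR_ge0.
by rewrite lee_wpmul2l ?lee_fin.
Qed.

End series.

(** * Integrals of step functions *)

Section integral_steps.
Context d (T : measurableType d) (R : realType).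
Variable mu : {measure set T -> \bar R}.
Implicit Types (D A N : set T) (F G : T -> \bar R) (c v : \bar R).
Local Open Scope ereal_scope.

(* Unlike [ge0_le_integral], no measurability is required: the integral of a
   nonnegative function is a supremum over simple functions below it. *)
Lemma ge0_le_integral_patch D E F G :
  (forall x, D x -> 0 <= F x) -> (forall x, E x -> 0 <= G x) ->
  (forall x, D x -> ~ E x -> F x = 0) ->
  (forall x, D x -> E x -> F x <= G x) ->
  \int[mu]_(x in D) F x <= \int[mu]_(x in E) G x.
Proof.
move=> F0 G0 DE FG; rewrite !ge0_integralE//.
apply: ereal_sup_le => _ [h /= hF <-]; exists h => //= x.
apply: (le_trans (hF x)); rewrite /patch.
case: ifPn => [/[!inE] Dx|_]; last first.
  by case: ifPn => [|_]; [rewrite inE => /G0|exact: lexx].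
case: ifPn => [/[!inE] Ex|Ex]; first exact: FG.
by rewrite DE// => ?; apply: (negP Ex); rewrite inE.
Qed.

(** Bundling measurability, sign and value lets step functions with known integrals be assembled
    from indicators by sums and series. *)
Definition integral_is F c :=
  [/\ measurable_fun setT F, forall x, 0 <= F x & \int[mu]_x F x = c].

Lemma integral_is_indic A v : measurable A -> 0 <= v ->
  integral_is (fun x => v * (\1_A x)%:E) (v * mu A).
Proof.
move=> mA v0.
have mi : measurable_fun setT (fun x => (\1_A x)%:E : \bar R).
  by apply/measurable_EFinP; exact: measurable_indic.
have i0 x : 0 <= (\1_A x)%:E :> \bar R by rewrite lee_fin.
split; first exact: measurable_funeM.
  by move=> x; rewrite mule_ge0.
by rewrite ge0_integralZl// integral_indic// setIT.
Qed.

Lemma integral_isD F G c c' : integral_is F c -> integral_is G c' ->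
  integral_is (fun x => F x + G x) (c + c').
Proof.
move=> [mF F0 <-] [mG G0 <-]; split; first exact: emeasurable_funD.
  by move=> x; rewrite adde_ge0.
by rewrite ge0_integralD.
Qed.

Lemma integral_is_series (F : nat -> T -> \bar R) (c : nat -> \bar R) :
  (forall n, integral_is (F n) (c n)) ->
  integral_is (fun x => \sum_(0 <= n <oo) F n x) (\sum_(0 <= n <oo) c n).
Proof.
move=> Fc.
have mF n : measurable_fun setT (F n) by case: (Fc n).
have F0 n x : 0 <= F n x by case: (Fc n).
split.
- apply: (ge0_emeasurable_sum (P := xpredT)) => *; [exact: F0|exact: mF].
- by move=> x; exact: eseries_ge0.
rewrite integral_nneseries//.
by apply: eq_eseriesr => n _; case: (Fc n).
Qed.

(** Measurability is carried by the comparison function [G], so [F] may be an inner integral seen as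
    a function of the outer variable. *)
Lemma le_integral_is D F G c : integral_is G c ->
  (forall x, D x -> 0 <= F x) -> (forall x, D x -> F x <= G x) ->
  \int[mu]_(x in D) F x <= c.
Proof.
move=> [mG G0 <-] F0 FG; apply: ge0_le_integral_patch => //.
- by move=> x _ /(_ I).
- by move=> x Dx _; exact: FG.
Qed.

Lemma ge_integral_is D F G c : integral_is G c ->
  (forall x, D x -> 0 <= F x) ->
  (forall x, ~ D x -> G x = 0) -> (forall x, D x -> G x <= F x) ->
  c <= \int[mu]_(x in D) F x.
Proof.
move=> [mG G0 <-] F0 GD GF.
by apply: ge0_le_integral_patch => // x _; [exact: GD|exact: GF].
Qed.

Lemma sum_indic_in (A : nat -> set T) (v : nat -> \bar R) n x :
  (forall m, A m x -> m = n) -> A n x ->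
  \sum_(0 <= m <oo) (v m * (\1_(A m) x)%:E) = v n.
Proof.
move=> An Ax.
have A0 m : m != n -> v m * (\1_(A m) x)%:E = 0.
  move=> mn; rewrite indicE memNset ?mule0// => /An mn'.
  by rewrite mn' eqxx in mn.
rewrite (@nneseries_finite _ _ n.+1); last first.
  by move=> k nk; rewrite A0// gtn_eqF.
rewrite big_ord_recr/= big1 ?add0e; last first.
  by move=> i _; rewrite A0// ltn_eqF.
by rewrite indicE mem_set// mule1.
Qed.

Lemma sum_indic_notin (A : nat -> set T) (v : nat -> \bar R) x :
  (forall m, ~ A m x) -> \sum_(0 <= m <oo) (v m * (\1_(A m) x)%:E) = 0.
Proof.
move=> An; apply: eseries0 => m _ _.
by rewrite indicE memNset ?mule0.
Qed.

End integral_steps.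

(** * Dyadic shells at the endpoints of the unit interval *)

Section pieces.
Context {R : realType}.
Implicit Types (e : bool) (t u x : R).
Local Notation mu := (@lebesgue_measure R).

(* Distance of [t] to the endpoint [0] ([e = false]) or [1] ([e = true]) of the
   unit interval. *)
Definition corner e t : R := if e then 1 - t else t.

Definition halfp n : R := 2^-1 ^+ n.

(** Dyadic shells shrinking to the point at distance [u] from the endpoint selected by [e]. For
    [u = 0] they shrink to that endpoint itself; for a Haar function [u] will locate the near end of
    its support. *)
Definition piece e u n : set R :=
  [set x | halfp n.+1 < corner e x - u <= halfp n].

Lemma cornerK e : involutive (corner e).
Proof. by case: e => // t; rewrite /corner opprB addrC subrK. Qed.

Lemma halfp_gt0 n : 0 < halfp n.
Proof. by rewrite exprn_gt0// invr_gt0. Qed.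

Lemma halfpS n : halfp n.+1 = halfp n / 2.
Proof. by rewrite /halfp exprSr. Qed.

Lemma le_halfp m n : (m <= n)%N -> halfp n <= halfp m.
Proof.
move=> mn; rewrite /halfp; apply: ler_wiXn2l => //.
by rewrite invf_le1// ler1n.
Qed.

Lemma halfp0 : halfp 0 = 1. Proof. by []. Qed.

Lemma halfp_le1 n : halfp n <= 1.
Proof. by rewrite -halfp0 le_halfp. Qed.

Lemma halfpE n : halfp n = 2 `^ (- n%:R).
Proof. by rewrite powRN powR_mulrn// /halfp exprVn. Qed.

Lemma pieceE e u n : piece e u n =
  if e then `[1 - u - halfp n, 1 - u - halfp n.+1[%classic
  else `]u + halfp n.+1, u + halfp n]%classic.
Proof.
apply/seteqP; rewrite /piece /corner; case: e; split => x /=; rewrite in_itv/=.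
all: by move=> /andP[? ?]; apply/andP; split; lra.
Qed.

Lemma measurable_piece e u n : measurable (piece e u n).
Proof. by rewrite pieceE; case: e; exact: measurable_itv. Qed.

Lemma piece_measure e u n : mu (piece e u n) = (halfp n.+1)%:E.
Proof.
have h0 := halfp_gt0 n.+1; have hS := halfpS n.
rewrite pieceE; case: e; rewrite lebesgue_measure_itv/= lte_fin ifT -?EFinD.
- by congr EFin; lra.
- by lra.
- by congr EFin; lra.
- by lra.
Qed.

Lemma piece_inj e u m n x : piece e u m x -> piece e u n x -> m = n.
Proof.
wlog mn : m n / (m <= n)%N => [hw|].
  case/orP: (leq_total m n) => mn xm xn; first exact: hw.
  by apply/esym; exact: hw.
move=> /= /andP[xm _] /andP[_ xn]; apply/eqP; rewrite eqn_leq mn/=.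
rewrite leqNgt; apply/negP => {}mn.
by have := lt_le_trans xm xn; rewrite ltNge le_halfp.
Qed.

(** Take the least index whose power of 1/2 lies strictly below the distance; its predecessor is the
    shell. The form [k + m] matches series that start at level [k]. *)
Lemma piece_cover e u k x : 0 < corner e x - u <= halfp k ->
  exists m, piece e u (k + m) x.
Proof.
move=> /andP[t0 tk]; set t := corner e x - u in t0 tk *.
have [n nt] : exists n, halfp n < t.
  have := @cvg_expr R 2^-1; rewrite ger0_norm// invf_lt1// ltr1n => /(_ isT).
  move=> /cvgrPdist_lt /(_ _ t0) [n _ /(_ n (leqnn _))].
  by rewrite /= sub0r normrN gtr0_norm ?halfp_gt0// => ?; exists n.
have ex : exists n, halfp n < t by exists n.
case: (ex_minnP ex) => -[|m] mt mmin.
  by have := lt_le_trans mt (le_trans tk (halfp_le1 k)); rewrite halfp0 ltxx.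
have tm : t <= halfp m.
  by rewrite leNgt; apply/negP => /mmin; rewrite ltnn.
have km : (k <= m)%N.
  by rewrite leqNgt; apply/negP => /le_halfp; rewrite leNgt (lt_le_trans mt tk).
by exists (m - k)%N; rewrite subnKC//= /piece/= -/t mt.
Qed.

Lemma piece_sub01 e n x : piece e 0 n x -> 0 <= x <= 1.
Proof.
have := halfp_gt0 n.+1; have := halfp_le1 n.
by rewrite /piece/=; case: e => /= ? ? /andP[? ?]; apply/andP; split; lra.
Qed.

Local Open Scope ereal_scope.

Let mpiece := measurable_piece.

(** Every interior point lies in exactly one shell of each endpoint, so [g] is dominated by the sum
    of two step functions, one per endpoint. *)
Lemma int01_le (g : R -> \bar R) (v w : nat -> \bar R) :
  (forall n, 0 <= v n) -> (forall n, 0 <= w n) ->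
  (forall x, 0 <= g x) ->
  (forall x n m, piece false 0 n x -> piece true 0 m x -> g x <= v n + w m) ->
  \int[mu]_(x in `[0%R, 1%R]) g x <=
  \sum_(0 <= n <oo) (v n * (halfp n.+1)%:E) +
  \sum_(0 <= n <oo) (w n * (halfp n.+1)%:E).
Proof.
move=> v0 w0 g0 gvw.
(* The endpoints lie in no shell of their own endpoint. The majorant is set to [+oo] on them, which
   costs nothing since [+oo * 0 = 0]. *)
pose N : set R := [set 0%R; 1%R].
have mN : measurable N by exact: measurableU.
have N0 : mu N = 0.
  by apply: countable_lebesgue_measure0; apply: finite_set_countable; exact: finite_set2.
have S (z : nat -> \bar R) e : (forall n, 0 <= z n) -> integral_is mu
    (fun x => \sum_(0 <= n <oo) (z n * (\1_(piece e 0 n) x)%:E))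
    (\sum_(0 <= n <oo) (z n * (halfp n.+1)%:E)).
  move=> z0; apply: integral_is_series => n.
  rewrite -(piece_measure e 0).
  exact: (integral_is_indic mu (mpiece _ _ _)).
have IN : integral_is mu (fun x => +oo * (\1_N x)%:E) 0.
  by rewrite -[X in integral_is _ _ X](mule0 +oo) -N0; exact: integral_is_indic.
have I := integral_isD (integral_isD (S v false v0) (S w true w0)) IN.
rewrite adde0 in I.
apply: (le_integral_is I) => // x /=; rewrite in_itv/= => /andP[x0 x1].
have sum0 (z : nat -> \bar R) e : (forall n, 0 <= z n) ->
    0 <= \sum_(0 <= n <oo) (z n * (\1_(piece e 0 n) x)%:E).
  by move=> z0; apply: eseries_ge0 => n; rewrite mule_ge0 ?lee_fin.
have [xN|xN] := pselect (N x).
  rewrite [X in _ + _ * X](_ : _ = 1%:E) ?mule1; last by rewrite indicE mem_set.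
  rewrite addey ?leey// gt_eqF// (lt_le_trans (ltNyr 0))//.
  by rewrite adde_ge0// sum0.
have [xn0 xn1] : x != 0%R /\ x != 1%R.
  by split; apply/eqP => x01; apply: xN; rewrite x01; [left|right].
have [n xn] : exists n, piece false 0 (0 + n) x.
  by apply: piece_cover; rewrite /= subr0 halfp0 x1 andbT lt_neqAle eq_sym xn0.
have [m xm] : exists m, piece true 0 (0 + m) x.
  apply: piece_cover; rewrite /= subr0 halfp0 subr_gt0 lt_neqAle xn1 x1/=.
  by rewrite gerBl.
rewrite (sum_indic_in v _ xn); last by move=> k xk; exact: piece_inj xk xn.
rewrite (sum_indic_in w _ xm); last by move=> k xk; exact: piece_inj xk xm.
rewrite (le_trans (gvw _ _ _ xn xm))// leeDl// mule_ge0// lee_fin.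
Qed.

(** The shells at a single endpoint are disjoint, so the step function built on them is a minorant.
    They start at index 1, whence the measures [halfp n.+2]. *)
Lemma int01_ge e (g : R -> \bar R) (v : nat -> \bar R) :
  (forall n, 0 <= v n) -> (forall x, 0 <= g x) ->
  (forall x n, piece e 0 n.+1 x -> v n <= g x) ->
  \sum_(0 <= n <oo) (v n * (halfp n.+2)%:E) <=
  \int[mu]_(x in `[0%R, 1%R]) g x.
Proof.
move=> v0 g0 vg.
have I : integral_is mu
    (fun x => \sum_(0 <= n <oo) (v n * (\1_(piece e 0 n.+1) x)%:E))
    (\sum_(0 <= n <oo) (v n * (halfp n.+2)%:E)).
  apply: integral_is_series => n.
  rewrite -(piece_measure e 0).
  exact: (integral_is_indic mu (mpiece _ _ _)).
apply: (ge_integral_is I) => // x xD.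
  apply: (sum_indic_notin (A := fun n => piece e 0 n.+1)) => m /piece_sub01.
  by move=> xm; apply: xD; rewrite /= in_itv.
have [[n xn]|nx] := pselect (exists n, piece e 0 n.+1 x); last first.
  rewrite (sum_indic_notin (A := fun n => piece e 0 n.+1))// => m xm.
  by apply: nx; exists m.
rewrite (sum_indic_in (A := fun n => piece e 0 n.+1) v _ xn); first exact: vg.
by move=> k xk; have /succn_inj := piece_inj xk xn.
Qed.

End pieces.

(** * Mixed norms of monotone functions *)

Section mixed.
Context {R : realType}.
Implicit Types (e : bool) (f : R * R -> \bar R) (p q : R) (b : nat -> nat -> \bar R).
Local Notation mu := (@lebesgue_measure R).
Local Open Scope ereal_scope.

Definition signed_part e f (x : R * R) : \bar R := maxe (if e then - f x else f x) 0.

Definition corner_val e f n1 n2 : \bar R :=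
  signed_part e f (corner e (halfp n1), corner e (halfp n2)).

(** With [q = p2 / p1] this is the [p2]-th power of the weighted mixed norm of the array; likewise
    [mixed_int] is the mixed norm before its outer root. *)
Definition dyadic_sum p q b : \bar R :=
  \sum_(0 <= n2 <oo) ((\sum_(0 <= n1 <oo)
    (b n1 n2 `^ p * (halfp n1)%:E)) `^ q * (halfp n2 : R)%:E).

Definition mixed_int p q f : \bar R :=
  \int[mu]_(x2 in `[0%R, 1%R])
    (\int[mu]_(x1 in `[0%R, 1%R]) (`|f (x1, x2)| `^ p)) `^ q.

Lemma signed_part_ge0 e f x : 0 <= signed_part e f x.
Proof. by rewrite /signed_part le_max lexx orbT. Qed.

Lemma signed_part_gt0 e f x : 0 < signed_part e f x ->
  signed_part e f x = if e then - f x else f x.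
Proof. by rewrite /signed_part lt_max ltxx orbF => /ltW ?; exact/max_idPl. Qed.

Lemma signed_part_le_abse e f x : signed_part e f x <= `|f x|.
Proof.
by rewrite /signed_part; case: e; rewrite ge_max abse_ge0 andbT ?lee_abs// -abseN lee_abs.
Qed.

Lemma abse_signed_part f x : exists e, `|f x| = signed_part e f x.
Proof.
have [f0|/ltW f0] := leP 0 (f x).
  by exists false; rewrite /signed_part gee0_abs//; apply/esym/max_idPl.
by exists true; rewrite /signed_part lee0_abs//; apply/esym/max_idPl; rewrite oppe_ge0.
Qed.

(** At each point the absolute value equals one of the two signed parts, hence no constant
    appears. *)
Lemma poweR_abse_le p f x (y z : \bar R) : (0 <= p)%R ->
  signed_part false f x <= y -> signed_part true f x <= z ->
  `|f x| `^ p <= y `^ p + z `^ p.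
Proof.
move=> p0 fy fz; have [e ->] := abse_signed_part f x.
have le a c : signed_part a f x <= c -> signed_part a f x `^ p <= c `^ p.
  by move=> ac; apply: le_poweR => //; exact: signed_part_ge0.
case: e; [apply: (le_trans (le _ _ fz))|apply: (le_trans (le _ _ fy))].
  by rewrite leeDr// poweR_ge0.
by rewrite leeDl// poweR_ge0.
Qed.

Lemma le_maxe0 (y z : \bar R) : y <= z -> maxe y 0 <= maxe z 0.
Proof. by move=> yz; rewrite ge_max !le_max yz lexx orbT. Qed.

(** Negating [f] and reflecting the variables each reverse the order, so both signed parts decrease
    with the distances to their own corner. *)
Lemma signed_part_mono e f (x1 x2 y1 y2 : R) : nonincreasing_each f ->
  (0 <= corner e y1)%R -> (corner e y1 <= corner e x1)%R ->
  (corner e x1 <= 1)%R ->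
  (0 <= corner e y2)%R -> (corner e y2 <= corner e x2)%R ->
  (corner e x2 <= 1)%R ->
  signed_part e f (x1, x2) <= signed_part e f (y1, y2).
Proof.
move=> mf; rewrite /corner /signed_part; case: e => a1 a2 a3 a4 a5 a6.
  by apply: le_maxe0; rewrite leeN2; apply: mf; lra.
by apply: le_maxe0; apply: mf; lra.
Qed.

Lemma signed_part_le_corner_val e f (x1 x2 : R) n1 n2 : nonincreasing_each f ->
  (halfp n1 <= corner e x1 <= 1)%R -> (halfp n2 <= corner e x2 <= 1)%R ->
  signed_part e f (x1, x2) <= corner_val e f n1 n2.
Proof.
move=> mf /andP[? ?] /andP[? ?].
by apply: signed_part_mono => //; rewrite cornerK// ltW// halfp_gt0.
Qed.

Lemma corner_val_le_signed_part e f (x1 x2 : R) n1 n2 : nonincreasing_each f ->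
  (0 <= corner e x1 <= halfp n1)%R -> (0 <= corner e x2 <= halfp n2)%R ->
  corner_val e f n1 n2 <= signed_part e f (x1, x2).
Proof.
move=> mf /andP[? ?] /andP[? ?].
by apply: signed_part_mono => //; rewrite cornerK// halfp_le1.
Qed.

Lemma corner_val_ge0 e f n1 n2 : 0 <= corner_val e f n1 n2.
Proof. exact: signed_part_ge0. Qed.

Lemma piece0 e n (x : R) : piece e 0 n x ->
  (halfp n.+1 <= corner e x <= 1)%R /\ (0 <= corner e x <= halfp n)%R.
Proof.
rewrite /piece/= subr0 => /andP[/ltW x1 x2]; rewrite x1 x2 andbT.
by rewrite (le_trans x2 (halfp_le1 n)) (le_trans _ x1)// ltW// halfp_gt0.
Qed.

(** On the product of the shells [n1.+1] and [n2.+1] both distances are at most those of the sample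
    point, so the corner value is a lower bound for the signed part there. *)
Lemma dyadic_sum_le_mixed_int p q : (0 < p)%R -> (0 < q)%R ->
  exists C : R, (0 < C)%R /\ forall e f, nonincreasing_each f ->
    dyadic_sum p q (fun n1 n2 => corner_val e f n1.+1 n2.+1) <=
    C%:E * mixed_int p q f.
Proof.
move=> p0 q0.
(* A shell of index [n.+1] has measure [halfp n / 4]; the inner factor 1/4 gets raised to the power
   [q], the outer one does not. *)
have K0 : (0 < (4^-1 `^ q * 4^-1) :> R)%R.
  by rewrite mulr_gt0 ?powR_gt0 ?invr_gt0.
have h4 n : (halfp n.+2)%:E = (4^-1 : R)%:E * (halfp n)%:E :> \bar R.
  by rewrite -EFinM !halfpS; congr EFin; field.
exists (4^-1 `^ q * 4^-1)^-1%R; split; first by rewrite invr_gt0.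
move=> e f mf; rewrite -lee_pdivrMl ?invrK//.
apply: (@le_trans _ _ (\sum_(0 <= n2 <oo) ((\sum_(0 <= n1 <oo)
    (corner_val e f n1.+1 n2.+1 `^ p * (halfp n1.+2)%:E)) `^ q *
    (halfp n2.+2 : R)%:E))).
  rewrite /dyadic_sum -nneseriesZl; last first.
    by move=> n _; rewrite mule_ge0 ?poweR_ge0 ?lee_fin ?(ltW (halfp_gt0 _)).
  rewrite le_eqVlt; apply/orP; left; apply/eqP; apply: eq_eseriesr => n2 _.
  rewrite h4 (eq_eseriesr (f := fun n1 => _ * (halfp n1.+2)%:E)
    (g := fun n1 => (4^-1 : R)%:E *
      (corner_val e f n1.+1 n2.+1 `^ p * (halfp n1)%:E))); last first.
    by move=> n1 _; rewrite h4 muleCA.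
  have b0 n1 : 0 <= corner_val e f n1.+1 n2.+1 `^ p * (halfp n1)%:E.
    by rewrite mule_ge0 ?poweR_ge0 ?lee_fin ?(ltW (halfp_gt0 _)).
  rewrite nneseriesZl// poweRMl//; last exact: eseries_ge0.
  by rewrite EFinM -!muleA; congr (_ * _); rewrite muleCA.
apply: (@int01_ge _ e) => [n|x|x2 n2 xn2]; [exact: poweR_ge0..|].
apply: le_poweR; first exact: ltW.
  by apply: eseries_ge0 => n1; rewrite mule_ge0 ?poweR_ge0 ?lee_fin ?(ltW (halfp_gt0 _)).
apply: (@int01_ge _ e) => [n|x|x1 n1 xn1]; [exact: poweR_ge0..|].
apply: le_poweR; [exact: ltW|exact: corner_val_ge0|].
apply: le_trans (signed_part_le_abse e f _).
by apply: corner_val_le_signed_part => //; [case: (piece0 xn1)|case: (piece0 xn2)].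
Qed.

(** Shells at 0 control the positive part and shells at 1 the negative part, while [b] dominates
    both corner arrays. The inner integral is bounded by two terms, and the power [q] of their sum
    yields the constant. *)
Lemma mixed_int_le_dyadic_sum p q : (0 < p)%R -> (0 < q)%R ->
  exists C : R, (0 < C)%R /\ forall f b, nonincreasing_each f ->
    (forall e n1 n2, corner_val e f n1.+1 n2.+1 <= b n1 n2) ->
    mixed_int p q f <= C%:E * dyadic_sum p q b.
Proof.
move=> p0 q0; exists (2 `^ q)%R; split; first exact: powR_gt0.
move=> f b mf fb.
have b0 n1 n2 : 0 <= b n1 n2.
  by apply: le_trans (fb false n1 n2); exact: corner_val_ge0.
have h0 n : 0 <= (halfp n : R)%:E by rewrite lee_fin (ltW (halfp_gt0 _)).
pose V n2 := \sum_(0 <= n1 <oo) (b n1 n2 `^ p * (halfp n1.+1)%:E).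
have V0 n2 : 0 <= V n2.
  by apply: eseries_ge0 => n1; rewrite mule_ge0 ?poweR_ge0.
pose v n2 := (2 `^ q)%:E * V n2 `^ q.
have v0 n2 : 0 <= v n2 by rewrite mule_ge0 ?poweR_ge0 ?lee_fin ?powR_ge0.
apply: (@le_trans _ _ (\sum_(0 <= n <oo) (v n * (halfp n.+1)%:E) +
                       \sum_(0 <= n <oo) (v n * (halfp n.+1)%:E))).
  apply: int01_le => // [x|x2 n2 m2 xn2 xm2]; first exact: poweR_ge0.
  have fp0 x1 : 0 <= `|f (x1, x2)| `^ p by exact: poweR_ge0.
  have inner : \int[mu]_(x1 in `[0%R, 1%R]) (`|f (x1, x2)| `^ p) <= V n2 + V m2.
    apply: int01_le => // [n|n|x1 n1 m1 xn1 xm1]; [exact: poweR_ge0..|].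
    apply: poweR_abse_le; first exact: ltW.
    + apply: le_trans (fb false _ _); apply: signed_part_le_corner_val => //.
        by case: (piece0 xn1).
      by case: (piece0 xn2).
    + apply: le_trans (fb true _ _); apply: signed_part_le_corner_val => //.
        by case: (piece0 xm1).
      by case: (piece0 xm2).
  apply: (le_trans (le_poweR (ltW q0) _ inner)); first exact: integral_ge0.
  by rewrite /v -ge0_muleDr ?poweR_ge0//; exact: poweRD_le.
rewrite -nneseriesD; [|by move=> *; exact: mule_ge0..].
rewrite /dyadic_sum -nneseriesZl; last by move=> n _; rewrite mule_ge0 ?poweR_ge0.
apply: le_eseries => n2; first by apply: adde_ge0; exact: mule_ge0.
rewrite -ge0_muleDr// -EFinD.
(* The two endpoints contribute [halfp n2.+1] each, which together make the weight [halfp n2]. *)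
have -> : (halfp n2.+1 + halfp n2.+1 = halfp n2 :> R)%R.
  by rewrite halfpS; field.
rewrite /v -muleA lee_wpmul2l ?lee_fin ?powR_ge0// lee_wpmul2r//.
apply: le_poweR => //; first exact: ltW.
apply: le_eseries => n1; first by rewrite mule_ge0 ?poweR_ge0.
by rewrite lee_wpmul2l ?poweR_ge0// lee_fin le_halfp.
Qed.

(** A quasi-triangle inequality: [poweRD_le] is used once for the inner exponent [p] and once for
    the outer exponent [q]. *)
Lemma dyadic_sumD p q : (0 < p)%R -> (0 < q)%R ->
  exists C : R, (0 < C)%R /\ forall b b',
    (forall n1 n2, 0 <= b n1 n2) -> (forall n1 n2, 0 <= b' n1 n2) ->
    dyadic_sum p q (fun n1 n2 => b n1 n2 + b' n1 n2) <=
    C%:E * (dyadic_sum p q b + dyadic_sum p q b').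
Proof.
move=> p0 q0; exists ((2 `^ p) `^ q * 2 `^ q)%R; split.
  by rewrite mulr_gt0 ?powR_gt0.
move=> b b' b0 b'0.
have h0 n : 0 <= (halfp n : R)%:E by rewrite lee_fin (ltW (halfp_gt0 _)).
pose V (c : nat -> nat -> \bar R) n2 :=
  \sum_(0 <= n1 <oo) (c n1 n2 `^ p * (halfp n1)%:E).
have V0 c n2 : 0 <= V c n2.
  by apply: eseries_ge0 => n1; rewrite mule_ge0 ?poweR_ge0.
rewrite -nneseriesD; [|by move=> *; rewrite mule_ge0 ?poweR_ge0..].
rewrite -nneseriesZl; last by move=> n _; rewrite adde_ge0 ?mule_ge0 ?poweR_ge0.
apply: le_eseries => n2; first by rewrite mule_ge0 ?poweR_ge0.
rewrite -ge0_muleDl ?poweR_ge0// muleA lee_wpmul2r//.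
have : V (fun n1 n2 => b n1 n2 + b' n1 n2) n2 <=
    (2 `^ p)%:E * (V b n2 + V b' n2).
  rewrite -nneseriesD; [|by move=> *; rewrite mule_ge0 ?poweR_ge0..].
  rewrite -nneseriesZl; last by move=> n _; rewrite adde_ge0 ?mule_ge0 ?poweR_ge0.
  apply: le_eseries => n1; first by rewrite mule_ge0 ?poweR_ge0.
  by rewrite -ge0_muleDl ?poweR_ge0// muleA lee_wpmul2r//; exact: poweRD_le.
move=> /(le_poweR (ltW q0) (V0 _ _)) /le_trans; apply.
rewrite poweRMl ?powR_ge0//; last by rewrite adde_ge0.
rewrite EFinM -muleA lee_wpmul2l ?lee_fin ?powR_ge0//.
exact: poweRD_le.
Qed.

End mixed.

(** * Discrete Hardy inequalities with Haar weights *)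

Section weights.
Context {R : realType}.
Implicit Types (p s : R).

(** Since [s + 1/2 = 1 - 1/p], the weight of level [k] against a shell of level [k + m] leaves decay
    in [m] at the rate 2 to the power [-(1 - 1/p)], which is below 1 because [p > 1]. *)
Lemma haar_weight_fwd p s k m : 0 < p -> s = 1 / 2 - 1 / p ->
  2 `^ (s * k%:R) * 2 `^ (k%:R / 2) * halfp (k + m) =
  (2 `^ (- (1 - p^-1))) ^+ m * (halfp (k + m) : R) `^ p^-1.
Proof.
move=> p0 ->; rewrite halfpE -powR_mulrn ?powR_ge0// -!powRrM -!powRD;
  try by rewrite pnatr_eq0 implybT.
by congr (_ `^ _); rewrite natrD; field; rewrite gt_eqF.
Qed.

(** Here the distance [n - l] between the levels gives decay at the rate 2 to the power [-1/p]. *)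
Lemma haar_weight_bwd p s n l : 0 < p -> s = 1 / 2 - 1 / p -> (l <= n)%N ->
  (halfp n : R) `^ p^-1 * 2 `^ (l%:R / 2) =
  (2 `^ (- p^-1)) ^+ (n - l) * 2 `^ (s * l%:R).
Proof.
move=> p0 -> ln; rewrite halfpE -powR_mulrn ?powR_ge0// -!powRrM -!powRD;
  try by rewrite pnatr_eq0 implybT.
by congr (_ `^ _); rewrite natrB//; field; rewrite gt_eqF.
Qed.

Lemma powR2N_lt1 p : 0 < p -> 0 < (2 `^ (- p) : R) < 1.
Proof.
move=> p0; rewrite powR_gt0//= powRN invf_lt1 ?powR_gt0//.
have := @gt0_ltr_powR R p p0 1 2; rewrite powR1; apply; rewrite ?nnegrE//.
by rewrite ltr1n.
Qed.

End weights.

(** * Passage between corner arrays and weighted Haar blocks *)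

Section discrete.
Context {R : realType}.
Implicit Types (p q s : R) (b B : nat -> nat -> \bar R).
Local Open Scope ereal_scope.

(** Rewrites a finite sum over levels as a series over the shift [m = n - l], padded by zeros, as
    the Hardy inequality requires. *)
Lemma sum_rev (F : nat -> \bar R) n :
  \sum_(l < n.+1) F l =
  \sum_(0 <= m <oo) (if (m <= n)%N then F (n - m)%N else 0).
Proof.
rewrite (@nneseries_finite _ _ n.+1); last first.
  by move=> k nk; rewrite leqNgt nk.
rewrite (reindex_inj rev_ord_inj)/=; apply: eq_bigr => i _.
by rewrite subSS -ltnS ltn_ord.
Qed.

Definition weighted_sum p1 p2 s1 s2 B : \bar R :=
  \sum_(0 <= k2 <oo) (\sum_(0 <= k1 <oo)
    (((2 `^ (s1 * k1%:R + s2 * k2%:R))%R%:E * B k1 k2) `^ p1)) `^ (p2 / p1).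

Lemma weighted_sumZ p1 p2 s1 s2 B (a : R) : (0 < p1)%R -> (0 <= a)%R ->
  (forall k1 k2, 0 <= B k1 k2) ->
  weighted_sum p1 p2 s1 s2 (fun k1 k2 => a%:E * B k1 k2) =
  (a `^ p2)%:E * weighted_sum p1 p2 s1 s2 B.
Proof.
move=> p10 a0 B0; rewrite /weighted_sum -nneseriesZl => [|*]; last exact: poweR_ge0.
apply: eq_eseriesr => k2 _.
rewrite (eq_eseriesr (g := fun k1 => (a `^ p1)%:E *
    ((2 `^ (s1 * k1%:R + s2 * k2%:R))%R%:E * B k1 k2) `^ p1)); last first.
  move=> k1 _; rewrite muleCA poweRMl// mule_ge0// lee_fin powR_ge0//.
rewrite nneseriesZl => [|*]; last exact: poweR_ge0.
rewrite poweRMl ?powR_ge0//; last by apply: eseries_ge0 => *; exact: poweR_ge0.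
by rewrite -powRrM mulrC divfK// gt_eqF.
Qed.

Variables (p1 p2 s1 s2 : R).
Hypotheses (hp1 : (1 < p1)%R) (hp2 : (1 < p2)%R).
Hypotheses (hs1 : s1 = (1 / 2 - 1 / p1)%R) (hs2 : s2 = (1 / 2 - 1 / p2)%R).

Let p10 : (0 < p1)%R. Proof. exact: lt_trans hp1. Qed.
Let p20 : (0 < p2)%R. Proof. exact: lt_trans hp2. Qed.
Let q0 : (0 < p2 / p1)%R. Proof. exact: divr_gt0. Qed.

Let h0 n : (0 <= halfp n :> R)%R. Proof. exact/ltW/halfp_gt0. Qed.

(** Absorbs the weights into the array, so that [dyadic_sum] becomes an unweighted mixed sum whose
    shifts are easy to bound. *)
Let scaled b n1 n2 : \bar R :=
  (halfp n1 `^ p1^-1 * halfp n2 `^ p2^-1)%:E * b n1 n2.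

Let scaled_ge0 b n1 n2 : (forall n1 n2, 0 <= b n1 n2) -> 0 <= scaled b n1 n2.
Proof. by move=> b0; rewrite mule_ge0// lee_fin mulr_ge0 ?powR_ge0. Qed.

Let dyadic_sumE b : (forall n1 n2, 0 <= b n1 n2) ->
  dyadic_sum p1 (p2 / p1) b =
  \sum_(0 <= n2 <oo) (\sum_(0 <= n1 <oo) (scaled b n1 n2) `^ p1) `^ (p2 / p1).
Proof.
move=> b0; apply: eq_eseriesr => n2 _.
rewrite [in RHS](eq_eseriesr (g := fun n1 => (halfp n2 `^ (p2^-1 * p1))%:E *
    (b n1 n2 `^ p1 * (halfp n1)%:E))); last first.
  move=> n1 _; rewrite poweRMl ?mulr_ge0 ?powR_ge0// powRM ?powR_ge0//.
  rewrite -!powRrM mulVf ?gt_eqF// powRr1// EFinM.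
  by rewrite -muleA muleCA; congr (_ * _); rewrite muleC.
rewrite nneseriesZl; last by move=> n1 _; rewrite mule_ge0 ?poweR_ge0 ?lee_fin.
rewrite poweRMl ?powR_ge0//; last first.
  by apply: eseries_ge0 => n1; rewrite mule_ge0 ?poweR_ge0 ?lee_fin.
rewrite muleC -powRrM (_ : (_ * _ * _ = 1)%R) ?powRr1//.
by field; rewrite !gt_eqF.
Qed.

Lemma weighted_sum_le_dyadic_sum : exists C : R, (0 < C)%R /\ forall B b,
  (forall k1 k2, 0 <= B k1 k2) -> (forall k1 k2, 0 <= b k1 k2) ->
  (forall k1 k2, B k1 k2 <= (2 `^ (k1%:R / 2) * 2 `^ (k2%:R / 2))%:E *
    \sum_(0 <= m2 <oo) \sum_(0 <= m1 <oo)
      ((halfp (k1 + m1) * halfp (k2 + m2))%:E * b (k1 + m1)%N (k2 + m2)%N)) ->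
  weighted_sum p1 p2 s1 s2 B <= C%:E * dyadic_sum p1 (p2 / p1) b.
Proof.
have r01 (p : R) : (1 < p)%R -> (0 < (2 `^ (- (1 - p^-1)) : R) < 1)%R.
  by move=> p1'; apply: powR2N_lt1; rewrite subr_gt0 invf_lt1// (lt_trans _ p1').
have [C [C0 H]] := hardy_geometric_mixed p10 q0 (r01 _ hp1) (r01 _ hp2).
exists C; split => // B b B0 b0 Bb.
(* Shifting towards higher levels only drops terms, so the sums of the shifted arrays are bounded by
   those of the original one. *)
pose X m1 m2 k1 k2 := scaled b (k1 + m1) (k2 + m2).
pose Y m2 k2 := \sum_(0 <= n <oo) (scaled b n (k2 + m2)) `^ p1.
have Y0 m2 k2 : 0 <= Y m2 k2 by apply: eseries_ge0 => n; exact: poweR_ge0.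
rewrite dyadic_sumE//.
set Z := (X in _ <= _ * X).
have Z0 : 0 <= Z by apply: eseries_ge0 => n; exact: poweR_ge0.
have X0 m1 m2 k1 k2 : 0 <= X m1 m2 k1 k2 by exact: scaled_ge0.
have XY m1 m2 k2 : \sum_(0 <= k1 <oo) (X m1 m2 k1 k2) `^ p1 <= Y m2 k2.
  by apply: (nneseries_addn_le (u := fun n => scaled b n (k2 + m2) `^ p1)) => k;
    exact: poweR_ge0.
have YZ m2 : \sum_(0 <= k2 <oo) (Y m2 k2) `^ (p2 / p1) <= Z.
  by apply: (nneseries_addn_le (u := fun n2 =>
    (\sum_(0 <= n <oo) scaled b n n2 `^ p1) `^ (p2 / p1))) => k; exact: poweR_ge0.
apply: le_trans (H X Y Z X0 Y0 Z0 XY YZ).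
apply: le_eseries => k2; first exact: poweR_ge0.
apply: le_poweR; [exact: ltW|by apply: eseries_ge0 => *; exact: poweR_ge0|].
apply: le_eseries => k1; first exact: poweR_ge0.
have w0 : (0 <= 2 `^ (s1 * k1%:R + s2 * k2%:R))%R by exact: powR_ge0.
apply: le_poweR; [exact: ltW|by rewrite mule_ge0|].
apply: (le_trans (lee_wpmul2l _ (Bb k1 k2))); first by rewrite lee_fin.
have hh n1 n2 : (0 <= halfp n1 * halfp n2 :> R)%R by rewrite mulr_ge0.
rewrite muleA -EFinM -nneseriesZl; last first.
  by move=> m2 _; apply: eseries_ge0 => m1; rewrite mule_ge0 ?lee_fin.
rewrite le_eqVlt; apply/orP; left; apply/eqP; apply: eq_eseriesr => m2 _.
rewrite -!nneseriesZl; first last.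
- by move=> m1 _; rewrite mule_ge0 ?lee_fin.
- by move=> m1 _; rewrite mule_ge0 ?scaled_ge0// lee_fin exprn_ge0 ?powR_ge0.
apply: eq_eseriesr => m1 _; rewrite /X /scaled !muleA -!EFinM; congr (_%:E * _).
rewrite powRD ?pnatr_eq0 ?implybT//.
have := haar_weight_fwd k1 m1 p10 hs1; have := haar_weight_fwd k2 m2 p20 hs2.
move: (2 `^ (s1 * _))%R (2 `^ (s2 * _))%R => w1 w2 E2 E1.
transitivity ((w1 * 2 `^ (k1%:R / 2) * halfp (k1 + m1)) *
  (w2 * 2 `^ (k2%:R / 2) * halfp (k2 + m2)))%R; first by ring.
by rewrite E1 E2; ring.
Qed.

Lemma dyadic_sum_le_weighted_sum : exists C : R, (0 < C)%R /\ forall B b,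
  (forall k1 k2, 0 <= B k1 k2) -> (forall k1 k2, 0 <= b k1 k2) ->
  (forall n1 n2, b n1 n2 <= \sum_(l2 < n2.+1) \sum_(l1 < n1.+1)
      ((2 `^ (l1%:R / 2) * 2 `^ (l2%:R / 2))%:E * B l1 l2)) ->
  dyadic_sum p1 (p2 / p1) b <= C%:E * weighted_sum p1 p2 s1 s2 B.
Proof.
have r01 (p : R) : (0 < p)%R -> (0 < (2 `^ (- p^-1) : R) < 1)%R.
  by move=> p1'; apply: powR2N_lt1; rewrite invr_gt0.
have [C [C0 H]] := hardy_geometric_mixed p10 q0 (r01 _ p10) (r01 _ p20).
exists C; split => // B b B0 b0 bB.
pose beta l1 l2 := (2 `^ (s1 * l1%:R + s2 * l2%:R))%:E * B l1 l2.
have beta0 l1 l2 : 0 <= beta l1 l2 by rewrite mule_ge0 ?lee_fin ?powR_ge0.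
(* Now the shift goes towards lower levels; padding by zeros keeps the sums of the shifted array
   equal to those of [beta]. *)
pose X m1 m2 k1 k2 := if (m2 <= k2)%N then
  if (m1 <= k1)%N then beta (k1 - m1)%N (k2 - m2)%N else 0 else 0.
pose Y m2 k2 := if (m2 <= k2)%N then
  \sum_(0 <= n <oo) (beta n (k2 - m2)%N) `^ p1 else 0.
have sb0 n2 : 0 <= \sum_(0 <= n <oo) (beta n n2) `^ p1.
  by apply: eseries_ge0 => n; exact: poweR_ge0.
have Y0 m2 k2 : 0 <= Y m2 k2 by rewrite /Y; case: ifP.
have X0 m1 m2 k1 k2 : 0 <= X m1 m2 k1 k2.
  by rewrite /X; case: ifP => // _; case: ifP.
rewrite dyadic_sumE//.
set Z := weighted_sum _ _ _ _ _.
have Z0 : 0 <= Z by apply: eseries_ge0 => n; exact: poweR_ge0.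
have pow0 p : (0 < p)%R -> (0 : \bar R) `^ p = 0 by move=> ?; rewrite poweR0r ?gt_eqF.
have XY m1 m2 k2 : \sum_(0 <= k1 <oo) (X m1 m2 k1 k2) `^ p1 <= Y m2 k2.
  rewrite /X /Y; case: ifP => _; last first.
    by rewrite eseries0// => *; rewrite pow0.
  rewrite -[leRHS](nneseries_subn m1); last by move=> *; exact: poweR_ge0.
  rewrite le_eqVlt; apply/orP; left; apply/eqP; apply: eq_eseriesr => k1 _.
  by case: ifP => // _; rewrite pow0.
have YZ m2 : \sum_(0 <= k2 <oo) (Y m2 k2) `^ (p2 / p1) <= Z.
  rewrite -[leRHS](nneseries_subn m2); last by move=> *; exact: poweR_ge0.
  rewrite le_eqVlt; apply/orP; left; apply/eqP; apply: eq_eseriesr => k2 _.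
  by rewrite /Y; case: ifP => // _; rewrite pow0.
apply: le_trans (H X Y Z X0 Y0 Z0 XY YZ).
apply: le_eseries => n2; first exact: poweR_ge0.
apply: le_poweR; [exact: ltW|by apply: eseries_ge0 => *; exact: poweR_ge0|].
apply: le_eseries => n1; first exact: poweR_ge0.
apply: le_poweR; [exact: ltW|exact: scaled_ge0|].
apply: (le_trans (lee_wpmul2l _ (bB n1 n2))).
  by rewrite lee_fin mulr_ge0 ?powR_ge0.
pose F2 l2 := \sum_(l1 < n1.+1)
  ((2 `^ (l1%:R / 2) * 2 `^ (l2%:R / 2))%:E * B l1 l2).
have bb0 l1 l2 : 0 <= (2 `^ (l1%:R / 2) * 2 `^ (l2%:R / 2))%:E * B l1 l2.
  by rewrite mule_ge0// lee_fin mulr_ge0 ?powR_ge0.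
rewrite (sum_rev F2) -nneseriesZl; last first.
  by move=> m2 _; case: ifP => // _; exact: sume_ge0.
apply: le_eseries => m2.
  rewrite mule_ge0 ?lee_fin ?mulr_ge0 ?powR_ge0//; case: ifP => // _.
  exact: sume_ge0.
case: ifPn => m2n; last first.
  rewrite mule0 mule_ge0 ?lee_fin ?exprn_ge0 ?powR_ge0//; apply: eseries_ge0 => m1.
  by rewrite mule_ge0 ?lee_fin ?exprn_ge0 ?powR_ge0.
rewrite /F2 (sum_rev (fun l1 =>
  (2 `^ (l1%:R / 2) * 2 `^ ((n2 - m2)%:R / 2))%:E * B l1 (n2 - m2)%N)).
rewrite -!nneseriesZl; first last.
- by move=> m1 _; case: ifP.
- by move=> m1 _; rewrite mule_ge0 ?lee_fin ?exprn_ge0 ?powR_ge0.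
rewrite le_eqVlt; apply/orP; left; apply/eqP; apply: eq_eseriesr => m1 _.
rewrite /X m2n; case: ifPn => m1n; last by rewrite !mule0.
rewrite /beta !muleA -!EFinM; congr (_%:E * _).
rewrite powRD ?pnatr_eq0 ?implybT//.
have := haar_weight_bwd p10 hs1 (leq_subr m1 n1).
have := haar_weight_bwd p20 hs2 (leq_subr m2 n2).
rewrite !subKn//.
move: (halfp n1 `^ _)%R (halfp n2 `^ _)%R => w1 w2 E2 E1.
transitivity ((w1 * 2 `^ ((n1 - m1)%:R / 2)) *
  (w2 * 2 `^ ((n2 - m2)%:R / 2)))%R; first by ring.
by rewrite E1 E2; ring.
Qed.

End discrete.

(** * Haar coefficients of monotone functions *)

Section haar_facts.
Context {R : realType}.
Implicit Types (e : bool) (x t : R).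

Lemma measurable_haar k j : measurable_fun setT (@haar R k j).
Proof.
rewrite /haar; case: ((k == 0%N) && (j == 0%N)); first exact: measurable_cst.
apply: measurable_fun_ifT; first by apply: measurable_and; exact: measurable_fun_ltr.
  exact: measurable_cst.
apply: measurable_fun_ifT; first by apply: measurable_and; exact: measurable_fun_ltr.
  exact: measurable_cst.
exact: measurable_cst.
Qed.

Lemma normr_haar_le k j x : haar_index k j -> `|haar k j x| <= 2 `^ (k%:R / 2).
Proof.
move=> kj; rewrite /haar; case: ifP => [/andP[/eqP -> _]|_].
  by rewrite mul0r powRr0 normr1.
case: ifP => _; first by rewrite ger0_norm ?powR_ge0.
case: ifP => _; first by rewrite normrN ger0_norm ?powR_ge0.
by rewrite normr0 powR_ge0.
Qed.

(** [u e] is the distance from the endpoint [e] of the unit interval to the nearer end of the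
    support; the shells based there cover the support from either side. *)
Lemma haar_supp k j : haar_index k j ->
  exists u : bool -> R, (forall e, 0 <= u e) /\
    forall x, 0 < x < 1 -> haar k j x != 0 ->
      forall e, 0 < corner e x - u e <= halfp k.
Proof.
move=> /andP[j0 jk].
have h1 : halfp k = (2 ^+ k)^-1 :> R by rewrite /halfp exprVn.
have pk : 0 < 2 ^+ k :> R by rewrite exprn_gt0.
have jk' : (j%:R : R) <= 2 ^+ k by rewrite -natrX ler_nat.
have [/andP[/eqP k0 /eqP ->]|kj] := boolP ((k == 0%N) && (j == 0%N)).
  exists (fun=> 0); split=> // x /andP[x0 x1] _ e.
  by rewrite k0 halfp0 subr0 /corner; case: e; lra.
have {}j0 : (1 : R) <= j%:R.
  rewrite ler1n; move: j0 kj; case: (k == 0%N) => //=.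
  by rewrite lt0n.
(* The support runs from [(j - 1) * halfp k] to [j * halfp k]; the first number is its distance from
   0, and 1 minus the second its distance from 1. *)
exists (fun e => if e then 1 - j%:R * halfp k else (j%:R - 1) * halfp k).
split=> [[]|x x01].
- by rewrite subr_ge0 h1 ler_pdivrMr// mul1r.
- by rewrite mulr_ge0 ?subr_ge0// h1 invr_ge0 ltW.
rewrite /haar (negbTE kj) => hx.
have [a1 a2] : (2 * j%:R - 2) / 2 ^+ k.+1 < x /\ x < 2 * j%:R / 2 ^+ k.+1.
  have ik : 0 < (2 ^+ k.+1)^-1 :> R by rewrite invr_gt0 exprn_gt0.
  have d1 : (2 * j%:R - 2) / 2 ^+ k.+1 <= (2 * j%:R - 1) / 2 ^+ k.+1 :> R.
    by rewrite ler_wpM2r ?(ltW ik)//; lra.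
  have d2 : (2 * j%:R - 1) / 2 ^+ k.+1 <= 2 * j%:R / 2 ^+ k.+1 :> R.
    by rewrite ler_wpM2r ?(ltW ik)//; lra.
  move: hx; case: ifPn => [/andP[b1 b2] _|_].
    by split=> //; apply: lt_le_trans d2.
  case: ifPn => [/andP[b1 b2] _|_]; last by rewrite eqxx.
  by split=> //; apply: le_lt_trans b1.
have c1 : (j%:R - 1) * halfp k < x.
  by move: a1; congr (_ < _); rewrite h1 exprS; field; rewrite gt_eqF.
have c2 : x < j%:R * halfp k.
  by move: a2; congr (_ < _); rewrite h1 exprS; field; rewrite gt_eqF.
by case; rewrite /corner; apply/andP; split; nra.
Qed.

End haar_facts.

(** * Upper bounds for Haar coefficients by corner values *)

Section coefficient_upper.
Context {R : realType}.
Implicit Types (e : bool) (f : R * R -> \bar R).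
Local Notation mu := (@lebesgue_measure R).
Local Notation mu2 := (mu \x mu)%E.
Local Open Scope ereal_scope.

Lemma measurable_unit_square : measurable (@unit_square R).
Proof. by apply: measurableX; exact: measurable_itv. Qed.

Lemma measurable_tensor (g1 g2 : R -> R) : measurable_fun setT g1 ->
  measurable_fun setT g2 ->
  measurable_fun setT (fun x : R * R => g1 x.1 * g2 x.2)%R.
Proof.
move=> m1 m2; apply: measurable_funM.
  exact: (measurableT_comp m1).
exact: (measurableT_comp m2).
Qed.

Lemma measurable_haar2 k1 k2 j1 j2 :
  measurable_fun setT (fun x : R * R => haar k1 j1 x.1 * haar k2 j2 x.2)%R.
Proof. by apply: measurable_tensor; exact: measurable_haar. Qed.

Lemma lebesgue2_rect (A B : set R) : measurable A -> measurable B ->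
  mu2 (A `*` B) = mu A * mu B.
Proof. by move=> mA mB; exact: product_measure1E. Qed.

Lemma product_null (N : set R) : measurable N -> mu N = 0 ->
  measurable ((N `*` setT) `|` (setT `*` N)) /\
  mu2 ((N `*` setT) `|` (setT `*` N)) = 0.
Proof.
move=> mN N0.
have m1 : measurable (N `*` [set: R]) by exact: measurableX.
have m2 : measurable ([set: R] `*` N) by exact: measurableX.
split; first exact: measurableU.
rewrite measureU0//.
  by rewrite [LHS](lebesgue2_rect mN measurableT) N0 mul0e.
by rewrite [LHS](lebesgue2_rect measurableT mN) N0 mule0.
Qed.

Lemma lee_abs_fine (y : \bar R) : (`|fine y|%R)%:E <= `|y|.
Proof. by case: y => [y| |]; rewrite /= ?normr0 ?leey. Qed.

(** The support rectangle is cut into products of shells, based at its vertex facing (0, 0) for the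
    positive part and at the one facing (1, 1) for the negative part. The bound depends on the
    levels only, hence passes to the supremum over positions. *)
Lemma haar_coef_le f k1 k2 j1 j2 : in_L1 f -> nonincreasing_each f ->
  haar_index k1 j1 -> haar_index k2 j2 ->
  (`|haar_coef f k1 k2 j1 j2|%R)%:E <=
  (2 `^ (k1%:R / 2) * 2 `^ (k2%:R / 2))%:E *
    \sum_(0 <= m2 <oo) \sum_(0 <= m1 <oo)
      ((halfp (k1 + m1) * halfp (k2 + m2))%:E *
       (corner_val false f (k1 + m1).+1 (k2 + m2).+1 +
        corner_val true f (k1 + m1).+1 (k2 + m2).+1)).
Proof.
move=> f1 mf kj1 kj2.
have [u1 [u10 U1]] := @haar_supp R _ _ kj1.
have [u2 [u20 U2]] := @haar_supp R _ _ kj2.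
set c := (2 `^ _ * 2 `^ _)%R.
have c0 : (0 <= c)%R by rewrite mulr_ge0 ?powR_ge0.
apply: (le_trans (lee_abs_fine _)).
have mF : measurable_fun (@unit_square R)
    (fun x => f x * (haar k1 j1 x.1 * haar k2 j2 x.2)%:E).
  apply: emeasurable_funM; first exact: measurable_int f1.
  by apply/measurable_EFinP/measurable_funTS; exact: measurable_haar2.
apply: (le_trans (le_abse_integral mu2 measurable_unit_square mF)).
(* On the boundary lines of the square [f] may be infinite and [haar_supp] says nothing; the
   majorant is [+oo] on this null set. *)
pose N : set R := [set 0%R; 1%R].
have mN : measurable N by exact: measurableU.
have N0 : mu N = 0.
  by apply: countable_lebesgue_measure0; apply: finite_set_countable; exact: finite_set2.
have [mNN NN0] := product_null mN N0.
pose A e n1 n2 := piece e (u1 e) n1 `*` piece e (u2 e) n2.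
have mA e n1 n2 : measurable (A e n1 n2).
  by apply: measurableX; exact: measurable_piece.
have b0 e n1 n2 : 0 <= corner_val e f n1.+1 n2.+1 by exact: corner_val_ge0.
have hh n1 n2 : (0 <= halfp n1 * halfp n2 :> R)%R.
  by rewrite mulr_ge0 ?(ltW (halfp_gt0 _)).
have IS e : integral_is mu2
    (fun x => \sum_(0 <= m2 <oo) \sum_(0 <= m1 <oo)
      (c%:E * corner_val e f (k1 + m1).+1 (k2 + m2).+1 *
        (\1_(A e (k1 + m1)%N (k2 + m2)%N) x)%:E))
    (\sum_(0 <= m2 <oo) \sum_(0 <= m1 <oo)
      (c%:E * corner_val e f (k1 + m1).+1 (k2 + m2).+1 *
        (halfp (k1 + m1).+1 * halfp (k2 + m2).+1)%:E)).
  apply: integral_is_series => m2; apply: integral_is_series => m1.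
  have -> : (halfp (k1 + m1).+1 * halfp (k2 + m2).+1)%:E =
      mu2 (A e (k1 + m1)%N (k2 + m2)%N).
    rewrite [RHS]lebesgue2_rect; [|exact: measurable_piece..].
    by rewrite EFinM !piece_measure.
  apply: integral_is_indic; first exact: mA.
  by rewrite mule_ge0 ?lee_fin.
have IN : integral_is mu2
    (fun x => +oo * (\1_((N `*` setT) `|` (setT `*` N)) x)%:E) 0.
  by rewrite -[X in integral_is _ _ X](mule0 +oo) -NN0; exact: integral_is_indic.
have I := integral_isD (integral_isD (IS false) (IS true)) IN.
have t0 e n1 n2 (y : R) : (0 <= y)%R ->
    0 <= c%:E * corner_val e f n1.+1 n2.+1 * y%:E.
  by move=> y0; rewrite !mule_ge0 ?lee_fin.
apply: (le_trans (le_integral_is I _ _)).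
- by move=> x _; exact: abse_ge0.
- move=> x [/= + +]; rewrite !in_itv/= => /andP[x10 x11] /andP[x20 x21].
  have ind0 (B : set (R * R)) : (0 <= \1_B x :> R)%R by [].
  have S0 e : 0 <= \sum_(0 <= m2 <oo) \sum_(0 <= m1 <oo)
      (c%:E * corner_val e f (k1 + m1).+1 (k2 + m2).+1 *
        (\1_(A e (k1 + m1)%N (k2 + m2)%N) x)%:E).
    by apply: eseries_ge0 => m2; apply: eseries_ge0 => m1; exact: t0.
  have [xN|xN] := pselect (((N `*` setT) `|` (setT `*` N)) x).
    rewrite [X in _ + _ * X](_ : _ = 1%:E) ?mule1; last by rewrite indicE mem_set.
    rewrite addey ?leey// gt_eqF// (lt_le_trans (ltNyr 0))//.
    by rewrite adde_ge0.
  have x1i : (0 < x.1 < 1)%R.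
    rewrite !lt_neqAle x10 x11 !andbT; apply/andP; split; apply/eqP => x01.
      by apply: xN; left; split => //; left.
    by apply: xN; left; split => //; right.
  have x2i : (0 < x.2 < 1)%R.
    rewrite !lt_neqAle x20 x21 !andbT; apply/andP; split; apply/eqP => x01.
      by apply: xN; right; split => //; left.
    by apply: xN; right; split => //; right.
  apply: (@le_trans _ _ (\sum_(0 <= m2 <oo) \sum_(0 <= m1 <oo)
      (c%:E * corner_val false f (k1 + m1).+1 (k2 + m2).+1 *
        (\1_(A false (k1 + m1)%N (k2 + m2)%N) x)%:E) +
      \sum_(0 <= m2 <oo) \sum_(0 <= m1 <oo)
      (c%:E * corner_val true f (k1 + m1).+1 (k2 + m2).+1 *
        (\1_(A true (k1 + m1)%N (k2 + m2)%N) x)%:E))); last first.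
    by rewrite leeDl// mule_ge0 ?lee_fin.
  have [h10|h10] := eqVneq (haar k1 j1 x.1) 0%R.
    by rewrite h10 mul0r mule0 abse0 adde_ge0.
  have [h20|h20] := eqVneq (haar k2 j2 x.2) 0%R.
    by rewrite h20 mulr0 mule0 abse0 adde_ge0.
  have [e fe] := abse_signed_part f x.
  apply: (@le_trans _ _ (\sum_(0 <= m2 <oo) \sum_(0 <= m1 <oo)
      (c%:E * corner_val e f (k1 + m1).+1 (k2 + m2).+1 *
        (\1_(A e (k1 + m1)%N (k2 + m2)%N) x)%:E))); last first.
    by case: (e); [rewrite leeDr|rewrite leeDl].
  have [n1 xn1] := piece_cover (U1 _ x1i h10 e).
  have [n2 xn2] := piece_cover (U2 _ x2i h20 e).
  apply: le_trans (nneseries_ge_term (u := fun m2 => \sum_(0 <= m1 <oo) _) n2 _);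
    last first.
    by move=> m2; apply: eseries_ge0 => m1; exact: t0.
  apply: le_trans (nneseries_ge_term (u := fun m1 => _ * (\1_(A _ _ _) _)%:E) n1 _);
    last first.
    by move=> m1; exact: t0.
  rewrite indicE mem_set ?mule1//.
  rewrite abseM fe muleC /=; apply: lee_pmul => //.
  + exact: signed_part_ge0.
  + rewrite lee_fin normrM; apply: ler_pM => //; exact: normr_haar_le.
  (* Because [u] is nonnegative, a point of the shell is at least as far from the corner of the
     square as from the vertex of the rectangle. This is where the position of the rectangle is
     forgotten. *)
  have pc (u : R) n y : (0 <= u)%R -> (0 < y < 1)%R -> piece e u n y ->
      (halfp n.+1 <= corner e y <= 1)%R.
    move=> u0 /andP[y0 y1]; rewrite /piece/= /corner => /andP[+ _].
    by case: (e) => ?; apply/andP; split; lra.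
  rewrite (surjective_pairing x); apply: signed_part_le_corner_val => //.
    exact: pc (u10 e) x1i xn1.
  exact: pc (u20 e) x2i xn2.
rewrite adde0 -nneseriesD; first last.
- by move=> *; apply: eseries_ge0 => *; exact: t0.
- by move=> *; apply: eseries_ge0 => *; exact: t0.
rewrite -nneseriesZl; last first.
  by move=> *; apply: eseries_ge0 => *; rewrite mule_ge0 ?adde_ge0 ?lee_fin.
apply: le_eseries => m2.
  by rewrite adde_ge0//; apply: eseries_ge0 => *; exact: t0.
rewrite -nneseriesD; first last.
- by move=> *; exact: t0.
- by move=> *; exact: t0.
rewrite -nneseriesZl; last by move=> *; rewrite mule_ge0 ?adde_ge0 ?lee_fin.
apply: le_eseries => m1; first by rewrite adde_ge0 ?t0.
rewrite -ge0_muleDl ?mule_ge0 ?lee_fin// -ge0_muleDr// -muleA lee_wpmul2l ?lee_fin//.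
rewrite muleC lee_wpmul2r ?adde_ge0// lee_fin.
by apply: ler_pM; rewrite ?(ltW (halfp_gt0 _))// le_halfp.
Qed.

Lemma block_sup_ge0 (a : nat -> nat -> nat -> nat -> R) k1 k2 : 0 <= block_sup a k1 k2.
Proof.
apply: (@le_trans _ _ (`|a k1 k2 1%N 1%N|%R)%:E); first by rewrite lee_fin.
apply: ereal_sup_ubound; exists (1%N, 1%N) => //=.
by rewrite /haar_index !orbT !expn_gt0.
Qed.

Lemma le_block_sup (a : nat -> nat -> nat -> nat -> R) k1 k2 j1 j2 :
  haar_index k1 j1 -> haar_index k2 j2 ->
  (`|a k1 k2 j1 j2|%R)%:E <= block_sup a k1 k2.
Proof. by move=> kj1 kj2; apply: ereal_sup_ubound; exists (j1, j2). Qed.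

Lemma block_sup_haar_le f k1 k2 : in_L1 f -> nonincreasing_each f ->
  block_sup (haar_coef f) k1 k2 <=
  (2 `^ (k1%:R / 2) * 2 `^ (k2%:R / 2))%:E *
    \sum_(0 <= m2 <oo) \sum_(0 <= m1 <oo)
      ((halfp (k1 + m1) * halfp (k2 + m2))%:E *
       (corner_val false f (k1 + m1).+1 (k2 + m2).+1 +
        corner_val true f (k1 + m1).+1 (k2 + m2).+1)).
Proof.
move=> f1 mf; apply: ge_ereal_sup => _ [[j1 j2] /= [kj1 kj2] <-].
exact: haar_coef_le.
Qed.

End coefficient_upper.

(** * Integration against bounded test functions *)

Section haar_functional.
Context {R : realType}.
Implicit Types (e : bool) (f : R * R -> \bar R) (psi : R * R -> R).
Local Notation mu := (@lebesgue_measure R).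
Local Notation mu2 := (mu \x mu)%E.
Local Notation Q := (@unit_square R).
Local Open Scope ereal_scope.

Let mQ : measurable Q := @measurable_unit_square R.

Lemma integrable_test f psi M : in_L1 f -> measurable_fun setT psi ->
  (forall x, `|psi x| <= M)%R ->
  mu2.-integrable Q (fun x => f x * (psi x)%:E).
Proof.
move=> f1 mpsi psiM.
have B : [bounded psi x | x in Q].
  exists M; split; first exact: num_real.
  by move=> y My x _ /=; apply: le_trans (psiM x) (ltW My).
have mQpsi : measurable_fun Q psi by exact: measurable_funTS.
exact: (@integrableMl _ _ _ mu2 Q mQ f psi f1 mQpsi B).
Qed.

(** An integrable [f] is finite almost everywhere. Passing to real values makes products distribute
    over finite sums, which can fail at infinite values. *)
Lemma fine_test f psi M : in_L1 f -> measurable_fun setT psi ->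
  (forall x, `|psi x| <= M)%R ->
  mu2.-integrable Q (fun x => (fine (f x) * psi x)%:E) /\
  \int[mu2]_(x in Q) (f x * (psi x)%:E) =
  \int[mu2]_(x in Q) (fine (f x) * psi x)%:E.
Proof.
move=> f1 mpsi psiM; have I := integrable_test f1 mpsi psiM.
have mf : measurable_fun Q (fun x => (fine (f x) * psi x)%:E).
  apply/measurable_EFinP; apply: measurable_funM; last exact: measurable_funTS.
  by apply: measurableT_comp; [exact: fine_measurable|exact: measurable_int f1].
split.
  apply: (@le_integrable _ _ _ mu2 Q mQ _ _ mf _ I) => x _.
  rewrite EFinM !abseM lee_wpmul2r//; exact: lee_abs_fine.
apply: ae_eq_integral => //; first exact: measurable_int I.
by apply: filterS (@integrable_ae _ _ _ mu2 Q mQ f f1) => x fx /fx ffx; rewrite EFinM fineK.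
Qed.

Lemma test_sum f (I : Type) (s : seq I) (c : I -> R) (psi : I -> R * R -> R) M :
  in_L1 f -> (forall i, measurable_fun setT (psi i)) ->
  (forall i x, `|psi i x| <= M)%R ->
  \int[mu2]_(x in Q) (f x * (\sum_(i <- s) c i * psi i x)%R%:E) =
  \sum_(i <- s) ((c i)%:E * \int[mu2]_(x in Q) (f x * (psi i x)%:E)).
Proof.
move=> f1 mpsi psiM.
have FI i := fine_test f1 (mpsi i) (psiM i).
have ms : measurable_fun setT (fun x => \sum_(i <- s) c i * psi i x)%R.
  by apply: measurable_sum => i; apply: measurable_funM.
have sM x : (`|\sum_(i <- s) c i * psi i x| <= \sum_(i <- s) `|c i| * M)%R.
  apply: (le_trans (ler_norm_sum _ _ _)); apply: ler_sum => i _.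
  by rewrite normrM ler_wpM2l.
rewrite (fine_test f1 ms sM).2.
transitivity (\int[mu2]_(x in Q)
    \sum_(i <- s) ((c i)%:E * (fine (f x) * psi i x)%:E)).
  apply: eq_integral => x _; rewrite mulr_sumr -sumEFin.
  by apply: eq_bigr => i _; rewrite -EFinM mulrCA.
rewrite integral_sum//; last by move=> i; apply: integrableZl => //; exact: (FI i).1.
apply: eq_bigr => i _; rewrite integralZl//; last exact: (FI i).1.
by rewrite (FI i).2.
Qed.

Lemma haar_coefK f k1 k2 j1 j2 : in_L1 f ->
  haar_index k1 j1 -> haar_index k2 j2 ->
  \int[mu2]_(x in Q) (f x * (haar k1 j1 x.1 * haar k2 j2 x.2)%:E) =
  (haar_coef f k1 k2 j1 j2)%:E.
Proof.
move=> f1 kj1 kj2; rewrite /haar_coef fineK//; apply: integrable_fin_num => //.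
have hM (x : R * R) : (`|haar k1 j1 x.1 * haar k2 j2 x.2| <=
    2 `^ (k1%:R / 2) * 2 `^ (k2%:R / 2))%R.
  by rewrite normrM ler_pM ?normr_haar_le.
exact: integrable_test f1 (@measurable_haar2 _ k1 k2 j1 j2) hM.
Qed.

End haar_functional.

(** * The Haar kernel at a corner *)

Section edge_sum.
Context {R : realType}.
Implicit Types (e : bool) (x : R).

(* The Haar functions whose support is adjacent to a given corner, preceded by
   the constant one: index [0] is [haar 0 0], index [l.+1] has level [l]. *)
Definition edge_pos e i := if i is l.+1 then (if e then 2 ^ l else 1)%N else 0%N.

Definition edge_coef e i : R :=
  if i is l.+1 then (-1) ^+ e * 2 `^ (l%:R / 2) else 1.

Lemma edge_index e i : haar_index i.-1 (edge_pos e i).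
Proof. by case: i => [|l] //; rewrite /haar_index; case: e; rewrite /= expn_gt0 ?leqnn orbT. Qed.

Lemma normr_edge_coef e i : `|edge_coef e i| = 2 `^ (i.-1%:R / 2).
Proof.
case: i => [|l] /=; first by rewrite mul0r powRr0 normr1.
by rewrite normrM normr_sign mul1r ger0_norm ?powR_ge0.
Qed.

(** The sign makes the half of the support nearer to the corner carry the positive value at both
    endpoints. *)
Lemma edge_haarE e l x : 0 < corner e x < 1 ->
  corner e x != halfp l.+1 -> corner e x != halfp l ->
  (-1) ^+ e * haar l (edge_pos e l.+1) x =
  if corner e x < halfp l.+1 then 2 `^ (l%:R / 2)
  else if corner e x < halfp l then - 2 `^ (l%:R / 2) else 0.
Proof.
move=> /andP[x0 x1] xS xl.
have p1 : 0 < 2 ^+ l :> R by rewrite exprn_gt0.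
have hl : halfp l = (2 ^+ l)^-1 :> R by rewrite /halfp exprVn.
have hS := @halfpS R l; have h0 := @halfp_gt0 R l.
rewrite /haar; set j := edge_pos _ _.
have -> : (l == 0%N) && (j == 0%N) = false.
  apply/negbTE; rewrite negb_and; apply/orP; right.
  by rewrite /j /=; case: (e); rewrite -lt0n ?expn_gt0.
have [-> [-> ->]] : (2 * j%:R - 2) / 2 ^+ l.+1 = (if e then 1 - halfp l else 0) :> R /\
   (2 * j%:R - 1) / 2 ^+ l.+1 = (if e then 1 - halfp l.+1 else halfp l.+1) :> R /\
   2 * j%:R / 2 ^+ l.+1 = (if e then 1 else halfp l) :> R.
  rewrite hS hl exprS /j /=; case: (e); rewrite ?natrX.
    by split; [|split]; field; rewrite gt_eqF.
  by split; [|split]; field; rewrite gt_eqF.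
move: x0 x1 xS xl hS h0; rewrite /corner; set h := halfp l; set h' := halfp l.+1.
move=> x0 x1 + + hS h0; case: (e) x0 x1 => x0 x1 xS xl.
  rewrite expr1 mulN1r; case: (ltrP (1 - x) h') => c1.
    rewrite ifF; last by apply/negbTE; rewrite negb_and -!leNgt; apply/orP; right; lra.
    by rewrite ifT ?opprK//; apply/andP; split; lra.
  have {}c1 : h' < 1 - x by rewrite lt_neqAle eq_sym xS.
  case: (ltrP (1 - x) h) => c2.
    by rewrite ifT//; apply/andP; split; lra.
  rewrite !ifF ?oppr0//; apply/negbTE; rewrite negb_and -!leNgt; apply/orP.
    by left; lra.
  by left; lra.
rewrite expr0 mul1r; case: (ltrP x h') => c1; first by rewrite x0.
have {}c1 : h' < x by rewrite lt_neqAle eq_sym xS.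
rewrite andbF; case: (ltrP x h) => c2; first by rewrite c1.
by rewrite andbF.
Qed.

(** The Dirichlet kernel of the Haar system at an endpoint: [edge_coef] is the one-sided limit there
    of the corresponding Haar function. *)
Definition edge_sum e k x : R :=
  \sum_(i < k.+1) edge_coef e i * haar i.-1 (edge_pos e i) x.

(** Induction on [k]: the new term has height [2 ^+ k], so it doubles the step on the nearer half of
    its support and cancels it on the farther half. *)
Lemma edge_sumE e k x : 0 < corner e x < 1 -> (forall n, corner e x != halfp n) ->
  edge_sum e k x = if corner e x < halfp k then 2 ^+ k else 0.
Proof.
move=> x01 xh; have /andP[x0 x1] := x01.
elim: k => [|k IH]; first by rewrite /edge_sum big_ord_recl big_ord0 addr0 /= mul1r halfp0 x1.
rewrite /edge_sum big_ord_recr -/(edge_sum e k x) IH.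
rewrite (_ : edge_coef e _ = 2 `^ (k%:R / 2) * (-1) ^+ e); last by rewrite mulrC.
rewrite -mulrA (edge_haarE x01)//=.
have pp : 2 `^ (k%:R / 2) * 2 `^ (k%:R / 2) = 2 ^+ k :> R.
  by rewrite -powRD ?pnatr_eq0 ?implybT// -splitr powR_mulrn.
have [c1|c1] := boolP (corner e x < halfp k.+1).
  rewrite ifT; last exact: lt_le_trans c1 (le_halfp (leqnSn k)).
  by rewrite pp exprS; ring.
by case: ifPn => c2; rewrite ?mulr0 ?addr0// mulrN pp subrr.
Qed.

End edge_sum.

(** * Bounds for corner values by Haar coefficients *)

Section coefficient_lower.
Context {R : realType}.
Implicit Types (e : bool) (f : R * R -> \bar R).
Local Notation mu := (@lebesgue_measure R).
Local Notation mu2 := (mu \x mu)%E.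
Local Notation Q := (@unit_square R).
Local Open Scope ereal_scope.

Let mQ : measurable Q := @measurable_unit_square R.

Definition corner_box e k : set R := [set x | 0 <= corner e x < halfp k]%R.

(** The normalised indicator of the corner interval: integrating against a product of two of these
    gives the mean over a corner rectangle. *)
Definition corner_step e k (x : R) : R := (2 ^+ k * \1_(corner_box e k) x)%R.

Lemma corner_boxE e k : corner_box e k =
  (if e then `]1 - halfp k, 1]%classic else `[0, halfp k[%classic)%R.
Proof.
apply/seteqP; rewrite /corner_box /corner; case: e; split => x /=; rewrite in_itv/=.
all: by move=> /andP[? ?]; apply/andP; split; lra.
Qed.

Lemma measurable_corner_box e k : measurable (corner_box e k).
Proof. by rewrite corner_boxE; case: e; exact: measurable_itv. Qed.

Lemma corner_box_measure e k : mu (corner_box e k) = (halfp k)%:E.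
Proof.
have h0 := @halfp_gt0 R k.
rewrite corner_boxE; case: e; rewrite lebesgue_measure_itv/= lte_fin ifT -?EFinD.
- by congr EFin; lra.
- by lra.
- by congr EFin; lra.
- by lra.
Qed.

Lemma corner_step_ge0 e k x : (0 <= corner_step e k x)%R.
Proof. by rewrite mulr_ge0 ?exprn_ge0. Qed.

Lemma corner_step_le e k x : (`|corner_step e k x| <= 2 ^+ k)%R.
Proof.
by rewrite ger0_norm ?corner_step_ge0// ler_piMr ?exprn_ge0.
Qed.

Lemma measurable_corner_step e k : measurable_fun setT (corner_step e k).
Proof.
apply: measurable_funM; first exact: measurable_cst.
by apply: measurable_indic; exact: measurable_corner_box.
Qed.

Lemma edge_sum_le e k (x : R) :
  (`|edge_sum e k x| <= \sum_(i < k.+1) 2 `^ (i.-1%:R / 2) * 2 `^ (i.-1%:R / 2))%R.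
Proof.
apply: (le_trans (ler_norm_sum _ _ _)); apply: ler_sum => i _.
by rewrite normrM normr_edge_coef ler_wpM2l ?powR_ge0// normr_haar_le// edge_index.
Qed.

Lemma measurable_edge_sum e k : measurable_fun setT (@edge_sum R e k).
Proof.
apply: measurable_sum => i; apply: measurable_funM => //; exact: measurable_haar.
Qed.

Lemma tensor_le (g1 g2 : R -> R) (M1 M2 : R) : (forall x, `|g1 x| <= M1)%R ->
  (forall x, `|g2 x| <= M2)%R ->
  forall x : R * R, (`|g1 x.1 * g2 x.2| <= M1 * M2)%R.
Proof. by move=> g1M g2M x; rewrite normrM ler_pM. Qed.

Lemma edge_sum_step_ae e f k1 k2 : in_L1 f ->
  \int[mu2]_(x in Q) (f x * (edge_sum e k1 x.1 * edge_sum e k2 x.2)%:E) =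
  \int[mu2]_(x in Q) (f x * (corner_step e k1 x.1 * corner_step e k2 x.2)%:E).
Proof.
move=> f1.
(* Enumerates 0, 1 and the points at dyadic distance from the corner, outside which [edge_sum] and
   [corner_step] agree; a countable set is null. *)
pose d n : R := match n with
  0%N => 0%R | 1%N => 1%R | n.+2 => corner e (halfp n) end.
pose N := range d.
have cN : countable N.
  exact: (sub_countable (card_image_le d setT) (countableP setT)).
have mN : measurable N by apply: countable_measurable cN => t; exact: measurable_set1.
have N0 : mu N = 0 by exact: countable_lebesgue_measure0.
have [mNN NN0] := product_null mN N0.
have Ib := integrable_test f1
  (measurable_tensor (@measurable_edge_sum e k1) (@measurable_edge_sum e k2))
  (tensor_le (@edge_sum_le e k1) (@edge_sum_le e k2)).
have Is := integrable_test f1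
  (measurable_tensor (measurable_corner_step e k1) (measurable_corner_step e k2))
  (tensor_le (@corner_step_le e k1) (@corner_step_le e k2)).
have bs k x : (0 <= x <= 1)%R -> ~ N x -> edge_sum e k x = corner_step e k x.
  move=> /andP[x0 x1] Nx.
  have xn0 : x != 0%R by apply/eqP => xE; apply: Nx; exists 0%N.
  have xn1 : x != 1%R by apply/eqP => xE; apply: Nx; exists 1%N.
  have c01 : (0 < corner e x < 1)%R.
    by rewrite /corner; case: (e); apply/andP; split; lra.
  have xh n : corner e x != halfp n.
    by apply/eqP => xE; apply: Nx; exists n.+2 => //; rewrite /d -xE cornerK.
  rewrite edge_sumE// /corner_step indicE.
  have [c1|c1] := boolP (corner e x < halfp k)%R.
    by rewrite mem_set ?mulr1// /corner_box/= c1 andbT ltW//; case/andP: c01.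
  by rewrite memNset ?mulr0// /corner_box/= (negbTE c1) andbF.
apply: (@ae_eq_integral _ _ _ mu2) => //; [exact: measurable_int Ib|exact: measurable_int Is|].
exists ((N `*` setT) `|` (setT `*` N)); split => //.
move=> x /= Hx; apply: contrapT => /not_orP[xN1 xN2]; apply: Hx.
move=> [/= + +]; rewrite !in_itv/= => x1 x2.
by rewrite !bs// => xN; [apply: xN2|apply: xN1].
Qed.

(** A positive corner value bounds the signed part from below on the whole corner rectangle, so [f]
    has constant sign there and the absolute value of its mean is the mean of the signed part. *)
Lemma corner_val_le_int e f k1 k2 : in_L1 f -> nonincreasing_each f ->
  corner_val e f k1 k2 <=
  `| \int[mu2]_(x in Q) (f x * (edge_sum e k1 x.1 * edge_sum e k2 x.2)%:E) |.
Proof.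
move=> f1 mf; rewrite edge_sum_step_ae//.
have [b0|b0] := eqVneq (corner_val e f k1 k2) 0; first by rewrite b0 abse_ge0.
have {}b0 : 0 < corner_val e f k1 k2 by rewrite lt_neqAle eq_sym b0 corner_val_ge0.
set b := corner_val e f k1 k2 in b0 *.
pose psi (x : R * R) := (corner_step e k1 x.1 * corner_step e k2 x.2)%R.
have psi0 x : (0 <= psi x)%R by rewrite mulr_ge0 ?corner_step_ge0.
pose A := corner_box e k1 `*` corner_box e k2.
have psiE x : psi x = (2 ^+ k1 * 2 ^+ k2 * \1_A x)%R.
  rewrite /psi /corner_step mulrACA; congr (_ * _)%R.
  by rewrite !indicE -natrM mulnb; congr (_%:R); rewrite in_setX.
have inQ x : Q x -> (0 <= corner e x.1 /\ 0 <= corner e x.2)%R.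
  move=> [/= + +]; rewrite !in_itv/= => /andP[? ?] /andP[? ?].
  by rewrite /corner; case: (e); split; lra.
have bA x : A x -> b <= signed_part e f x.
  move=> [/= /andP[? /ltW ?] /andP[? /ltW ?]].
  by rewrite (surjective_pairing x); apply: corner_val_le_signed_part => //; apply/andP.
have fpart x : f x * (psi x)%:E =
    (if e then -%E else id) (signed_part e f x * (psi x)%:E).
  have [Ax|Ax] := pselect (A x); last first.
    by rewrite psiE indicE memNset// mulr0 !mule0; case: (e); rewrite ?oppe0.
  have := lt_le_trans b0 (bA x Ax); move=> /signed_part_gt0 ->.
  by case: (e) => //; rewrite mulNe oppeK.
have -> : `| \int[mu2]_(x in Q) (f x * (psi x)%:E) | =
    \int[mu2]_(x in Q) (signed_part e f x * (psi x)%:E).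
  have pp0 x : 0 <= signed_part e f x * (psi x)%:E by rewrite mule_ge0 ?signed_part_ge0 ?lee_fin.
  under eq_integral do rewrite fpart.
  case: (e) in pp0 *.
    by rewrite (@integral_ge0N _ _ _ mu2)// abseN gee0_abs// integral_ge0.
  by rewrite gee0_abs// integral_ge0.
have mA : measurable A by apply: measurableX; exact: measurable_corner_box.
pose c : R := (2 ^+ k1 * 2 ^+ k2)%R.
have c0 : (0 <= c)%R by rewrite mulr_ge0 ?exprn_ge0.
(* The kernel has total mass 1, so the constant [b] times the kernel has integral [b]. *)
have I : integral_is mu2 (fun x => b * c%:E * (\1_A x)%:E) b.
  have := integral_is_indic mu2 mA (mule_ge0 (ltW b0) (c0 : 0 <= c%:E)).
  congr (integral_is _ _ _).
  rewrite -muleA [X in c%:E * X](_ : _ = (halfp k1 * halfp k2)%:E).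
    rewrite -EFinM [(c * _)%R](_ : _ = 1%R) ?mule1//.
    rewrite /c /halfp mulrACA !exprVn !divff ?mulr1//; by rewrite expf_neq0.
  rewrite [LHS]lebesgue2_rect; [|exact: measurable_corner_box..].
  by rewrite EFinM !corner_box_measure.
apply: (ge_integral_is I) => x Qx.
- by rewrite mule_ge0 ?signed_part_ge0 ?lee_fin.
- rewrite indicE memNset ?mule0// => -[/= /andP[a1 a2] /andP[a3 a4]]; apply: Qx.
  have := halfp_le1 k1 (R := R); have := halfp_le1 k2 (R := R).
  move: a1 a2 a3 a4; rewrite /corner => a1 a2 a3 a4 h1 h2.
  by split; rewrite /= in_itv/=; case: (e) in a1 a2 a3 a4 *; apply/andP; split; lra.
- have [Ax|Ax] := pselect (A x); last first.
    by rewrite indicE memNset// mule0 mule_ge0 ?signed_part_ge0 ?lee_fin.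
  by rewrite psiE indicE mem_set// mule1 mulr1 lee_wpmul2r ?bA.
Qed.

(** Level 0 occurs twice, for the constant function and for the first proper Haar function, hence
    the factor 2; both variables together give the factor 4 below. *)
Lemma sum_pred_le (F : nat -> \bar R) n : (forall i, 0 <= F i) ->
  \sum_(i < n.+2) F i.-1 <= 2%:E * \sum_(l < n.+1) F l.
Proof.
move=> F0; rewrite big_ord_recl/= mule_natl mule2n leeD2r//.
by rewrite big_ord_recl leeDl// sume_ge0.
Qed.

Lemma corner_val_le_sum e f n1 n2 : in_L1 f -> nonincreasing_each f ->
  corner_val e f n1.+1 n2.+1 <=
  \sum_(l2 < n2.+1) \sum_(l1 < n1.+1)
    ((2 `^ (l1%:R / 2) * 2 `^ (l2%:R / 2))%:E *
     (4%:E * block_sup (haar_coef f) l1 l2)).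
Proof.
move=> f1 mf; apply: (le_trans (corner_val_le_int e _ _ f1 mf)).
(* The first component indexes the second variable, so that unfolding the pair gives the outer sum
   over [l2]. *)
pose I := ('I_n2.+2 * 'I_n1.+2)%type.
pose c (p : I) : R := (edge_coef e p.2 * edge_coef e p.1)%R.
pose psi (p : I) (x : R * R) : R := (haar p.2.-1 (edge_pos e p.2) x.1 *
  haar p.1.-1 (edge_pos e p.1) x.2)%R.
pose w (i : nat) : R := (2 `^ (i%:R / 2))%R.
have w0 i : (0 <= w i)%R by exact: powR_ge0.
have edge_sumE2 x : (edge_sum e n1.+1 x.1 * edge_sum e n2.+1 x.2 =
    \sum_(p <- index_enum I) c p * psi p x)%R.
  rewrite mulrC /edge_sum big_distrlr/= pair_bigA/=; apply: eq_bigr => p _.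
  by rewrite /c /psi; ring.
have mpsi p : measurable_fun setT (psi p) by exact: measurable_haar2.
pose M : R := (\sum_(p : I) w p.2.-1 * w p.1.-1)%R.
have psiM p x : (`|psi p x| <= M)%R.
  apply: (@le_trans _ _ (w p.2.-1 * w p.1.-1)%R).
    by rewrite normrM ler_pM// normr_haar_le// edge_index.
  by rewrite /M (bigD1 p)//= lerDl sumr_ge0// => q _; rewrite mulr_ge0.
under eq_integral do rewrite edge_sumE2.
rewrite (test_sum _ c f1 mpsi psiM).
apply: (le_trans (lee_abs_sum _ _ _)).
pose B := block_sup (haar_coef f).
have B0 l1 l2 : 0 <= B l1 l2 by exact: block_sup_ge0.
pose F l1 l2 := (w l1 * w l2)%:E * B l1 l2.
have F0 l1 l2 : 0 <= F l1 l2 by rewrite mule_ge0// lee_fin mulr_ge0.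
apply: (@le_trans _ _ (\sum_(p : I) F p.2.-1 p.1.-1)).
  apply: lee_sum => p _; rewrite haar_coefK ?edge_index// abseM.
  rewrite /F /B; apply: lee_pmul => //.
    by rewrite lee_fin /c normrM !normr_edge_coef.
  by apply: le_block_sup; exact: edge_index.
rewrite -(pair_bigA _ (fun (i : 'I_n2.+2) (j : 'I_n1.+2) => F j.-1 i.-1))/=.
apply: (@le_trans _ _ (\sum_(i < n2.+2) 2%:E * \sum_(l1 < n1.+1) F l1 i.-1)).
  by apply: lee_sum => i _; exact: (sum_pred_le (F := fun l1 => F l1 i.-1)).
apply: (le_trans (sum_pred_le (F := fun l2 => 2%:E * \sum_(l1 < n1.+1) F l1 l2) _ _)).
  by move=> i; rewrite mule_ge0// sume_ge0.
rewrite ge0_sume_distrr; last by move=> i _; rewrite mule_ge0// sume_ge0.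
apply: lee_sum => l2 _; rewrite muleA -EFinM ge0_sume_distrr//.
apply: lee_sum => l1 _; rewrite /F muleCA.
by rewrite (_ : 2 * 2 = 4 :> R)%R// -natrM.
Qed.

End coefficient_lower.

(** * The two estimates before taking the outer root *)

Section norm_equivalence.
Context {R : realType} (p1 p2 s1 s2 : R).
Hypotheses (hp1 : 1 < p1) (hp2 : 1 < p2).
Hypotheses (hs1 : s1 = 1 / 2 - 1 / p1) (hs2 : s2 = 1 / 2 - 1 / p2).
Local Open Scope ereal_scope.

Let p10 : (0 < p1)%R. Proof. exact: lt_trans hp1. Qed.
Let p20 : (0 < p2)%R. Proof. exact: lt_trans hp2. Qed.
Let q0 : (0 < p2 / p1)%R. Proof. exact: divr_gt0. Qed.

Lemma weighted_sum_le_mixed_int : exists C : R, (0 < C)%R /\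
  forall f, in_L1 f -> nonincreasing_each f ->
    weighted_sum p1 p2 s1 s2 (block_sup (haar_coef f)) <=
    C%:E * mixed_int p1 (p2 / p1) f.
Proof.
have [C1 [C10 H1]] := weighted_sum_le_dyadic_sum hp1 hp2 hs1 hs2.
have [C2 [C20 H2]] := dyadic_sumD p10 q0.
have [C3 [C30 H3]] := dyadic_sum_le_mixed_int p10 q0.
(* [C3] appears twice, once for each corner. *)
exists (C1 * (C2 * (C3 + C3)))%R; split; first by rewrite !mulr_gt0 ?addr_gt0.
move=> f f1 mf.
have b0 e n1 n2 := @corner_val_ge0 R e f n1 n2.
apply: (le_trans (H1 _ (fun n1 n2 => corner_val false f n1.+1 n2.+1 +
    corner_val true f n1.+1 n2.+1) _ _ _)).
- by move=> *; exact: block_sup_ge0.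
- by move=> *; exact: adde_ge0.
- by move=> k1 k2; exact: block_sup_haar_le.
rewrite EFinM -muleA lee_wpmul2l ?lee_fin ?(ltW C10)//.
apply: (le_trans (H2 _ _ _ _)) => //.
rewrite EFinM -muleA lee_wpmul2l ?lee_fin ?(ltW C20)//.
rewrite EFinD ge0_muleDl ?lee_fin ?(ltW C30)//.
by apply: leeD; exact: H3.
Qed.

Lemma mixed_int_le_weighted_sum : exists C : R, (0 < C)%R /\
  forall f, in_L1 f -> nonincreasing_each f ->
    mixed_int p1 (p2 / p1) f <=
    C%:E * weighted_sum p1 p2 s1 s2 (block_sup (haar_coef f)).
Proof.
have [C1 [C10 H1]] := mixed_int_le_dyadic_sum p10 q0.
have [C2 [C20 H2]] := dyadic_sum_le_weighted_sum hp1 hp2 hs1 hs2.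
exists (C1 * (C2 * 4 `^ p2))%R; split; first by rewrite !mulr_gt0 ?powR_gt0.
move=> f f1 mf.
pose B l1 l2 := 4%:E * block_sup (haar_coef f) l1 l2.
have B0 l1 l2 : 0 <= B l1 l2 by rewrite mule_ge0 ?block_sup_ge0.
pose b n1 n2 := \sum_(l2 < n2.+1) \sum_(l1 < n1.+1)
  ((2 `^ (l1%:R / 2) * 2 `^ (l2%:R / 2))%:E * B l1 l2).
have b0 n1 n2 : 0 <= b n1 n2.
  apply: sume_ge0 => l2 _; apply: sume_ge0 => l1 _.
  by rewrite mule_ge0// lee_fin mulr_ge0 ?powR_ge0.
apply: (le_trans (H1 f b mf _)).
  by move=> e n1 n2; exact: corner_val_le_sum.
rewrite EFinM -muleA lee_wpmul2l ?lee_fin ?(ltW C10)//.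
apply: (le_trans (H2 B b B0 b0 (fun n1 n2 => lexx _))).
rewrite EFinM -muleA lee_wpmul2l ?lee_fin ?(ltW C20)//.
by rewrite weighted_sumZ// => *; exact: block_sup_ge0.
Qed.

End norm_equivalence.

Theorem theorem2 (R : realType) (p1 p2 s1 s2 : R)
  (hp1 : 1 < p1) (hp2 : 1 < p2)
  (hs1 : s1 = 1 / 2 - 1 / p1) (hs2 : s2 = 1 / 2 - 1 / p2) :
  exists c1 c2 : R, [/\ 0 < c1, 0 < c2 &
    forall f : R * R -> \bar R, in_L1 f -> nonincreasing_each f ->
      (in_mixed_L p1 p2 f <-> in_seq_space p1 p2 s1 s2 (haar_coef f)) /\
      (c1%:E * seq_norm p1 p2 s1 s2 (haar_coef f) <= mixed_norm p1 p2 f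
        <= c2%:E * seq_norm p1 p2 s1 s2 (haar_coef f))%E].
Proof.
have [C1 [C10 H1]] := weighted_sum_le_mixed_int hp1 hp2 hs1 hs2.
have [C2 [C20 H2]] := mixed_int_le_weighted_sum hp1 hp2 hs1 hs2.
have p20 : 0 < p2 by exact: lt_trans hp2.
have c10 : 0 < C1 `^ p2^-1 by exact: powR_gt0.
have c20 : 0 < C2 `^ p2^-1 by exact: powR_gt0.
(* The estimates so far compare [p2]-th powers; the constants are their roots, inverted for the
   lower bound. *)
exists (C1 `^ p2^-1)^-1, (C2 `^ p2^-1); split; rewrite ?invr_gt0//.
move=> f f1 mf.
have root C x y : (0 < C)%R -> (0 <= x)%E -> (0 <= y)%E -> (x <= C%:E * y)%E ->
    (x `^ p2^-1 <= (C `^ p2^-1)%:E * y `^ p2^-1)%E.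
  move=> C0 x0 y0 xy; rewrite -poweRMl ?(ltW C0)//.
  by apply: le_poweR => //; rewrite invr_ge0 ltW.
have W0 : (0 <= weighted_sum p1 p2 s1 s2 (block_sup (haar_coef f)))%E.
  by apply: eseries_ge0 => k; exact: poweR_ge0.
have M0 : (0 <= mixed_int p1 (p2 / p1) f)%E.
  by apply: integral_ge0 => x _; exact: poweR_ge0.
have E1 : ((C1 `^ p2^-1)^-1%:E * seq_norm p1 p2 s1 s2 (haar_coef f) <=
    mixed_norm p1 p2 f)%E.
  rewrite lee_pdivrMl//; exact: (root _ _ _ C10 W0 M0 (H1 f f1 mf)).
have E2 : (mixed_norm p1 p2 f <=
    (C2 `^ p2^-1)%:E * seq_norm p1 p2 s1 s2 (haar_coef f))%E.
  exact: (root _ _ _ C20 M0 W0 (H2 f f1 mf)).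
split; last by rewrite E1 E2.
(* Finiteness passes across by the two inequalities, and measurability on the square comes from
   integrability. *)
split=> [[_ Mf]|Sf].
  move: E1; rewrite lee_pdivrMl// => /le_lt_trans; apply.
  by rewrite lte_mul_pinfty// ?lee_fin ?(ltW c10).
split; first exact: measurable_int f1.
apply: le_lt_trans E2 _.
by rewrite lte_mul_pinfty// ?lee_fin ?(ltW c20).
Qed.
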